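(* Let $2<p<\infty$, $r=p/2$, $t=2p/(p-2)$, and let $\phi\in\mathrm{Hol}(\mathbb D)$. Then the positive column operator $\mathcal P_{\phi,p}b=\sum_{j\ge0}b_j|X_j|^2$ is bounded from $\ell^r$ to $L^r(\mathbb T)$ if and only if $\mathscr C_{\phi,p}h=(X_jh)_{j\ge0}$ is bounded from $H^t$ to $\ell^t(H^2)$, and $$\|\mathscr C_{\phi,p}\|^2=\|\mathcal P_{\phi,p}\| .$$
   Context: $\mathbb D$ is the open unit disc, $\mathbb T$ the unit circle with normalized Haar measure $m$; $H^u$ is the Hardy space, identified with boundary functions; $\mathrm{Hol}(\mathbb D)$ is the space of holomorphic functions on $\mathbb D$; $1/p+1/p'=1$. For $\phi\in\mathrm{Hol}(\mathbb D)$ with Taylor coefficients $\widehat\phi(n)$, $\Delta_j\phi(z)=\sum_{2^j\le n<2^{j+1}}\widehat\phi(n)z^n$ and $X_j=2^{-j/p'}\Delta_j\phi$, $j\ge0$. The norm of $\ell^t(H^2)$ is $(\sum_j\|u_j\|_{2}^t)^{1/t}$. Norms are operator norms $H^t\to\ell^t(H^2)$ and $\ell^r\to L^r(\mathbb T,m)$ respectively. *)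

(* Defs.v *)
From HB Require Import structures.
From mathcomp Require Import all_boot all_order all_algebra.
From mathcomp Require Import all_classical all_reals all_analysis.
From mathcomp Require Import measurable_realfun.
From mathcomp Require Import complex.

Set Implicit Arguments.
Unset Strict Implicit.
Unset Printing Implicit Defensive.

Import Order.TTheory GRing.Theory Num.Theory.
Import numFieldNormedType.Exports.

Local Open Scope classical_set_scope.
Local Open Scope ring_scope.
Local Open Scope complex_scope.

Definition cabs (R : realType) (z : R[i]) : R := complex.Re `|z|.

Definition cmeasurable (R : realType) d (T : measurableType d) (f : T -> R[i]) :=
  measurable_fun [set: T] (fun x => complex.Re (f x) : measurableTypeR R) /\
  measurable_fun [set: T] (fun x => complex.Im (f x) : measurableTypeR R).

Section circle.
Variable R : realType.

Definition unit_complex := {z : R[i] | `|z| == 1}.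

HB.instance Definition _ := Choice.on unit_complex.

Fact norm1_unit : `|1 : R[i]| == 1. Proof. by rewrite normr1. Qed.

HB.instance Definition _ :=
  isPointed.Build unit_complex (exist (fun z : R[i] => `|z| == 1) 1 norm1_unit).

Definition reim (z : unit_complex) : (measurableTypeR R * measurableTypeR R)%type :=
  (complex.Re (sval z), complex.Im (sval z)).

(* The unit circle with the Borel sigma-algebra inherited from the plane. *)
Definition circle := g_sigma_algebra_preimageType reim.

Definition circle_val (z : circle) : R[i] := sval z.

Fact expi_subproof (x : R) : `|cos x +i* sin x| == 1.
Proof. by rewrite normc_def /= cos2Dsin2 sqrtr1. Qed.

Definition expi (x : measurableTypeR R) : circle :=
  exist (fun z : R[i] => `|z| == 1) (cos x +i* sin x) (expi_subproof x).

Fact measurable_expi : measurable_fun [set: measurableTypeR R] expi.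
Proof.
move=> _ _ [B mB <-]; rewrite setTI.
have mf : measurable_fun [set: measurableTypeR R]
    (fun x => (cos x, sin x) : (measurableTypeR R * measurableTypeR R)%type).
  apply/measurable_fun_pairP; split => /=; apply: continuous_measurable_fun.
    exact: continuous_cos.
  exact: continuous_sin.
by rewrite setTI -[X in _.-measurable X]setTI; exact: (mf measurableT B mB).
Qed.

HB.instance Definition _ := isMeasurableFun.Build _ _ _ _ expi measurable_expi.

Fact pi2_gt0 : 0 < 2 * pi :> R. Proof. by rewrite mulr_gt0// pi_gt0. Qed.

(* Normalized Haar measure: the law of exp(ix), x uniform on [0, 2 pi]. *)
Definition haar : probability circle R := distribution (uniform_prob pi2_gt0) expi.

End circle.

Coercion circle_val : circle >-> complex.
Arguments haar {R}.

Section disc.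
Variable R : realType.
Implicit Types (F phi : R[i] -> R[i]) (z : R[i]).

(* Elements of Hol(D) are represented by arbitrary extensions to the plane;
   R[i]^o carries the topology, and derivable over the field R[i] is complex
   differentiability. *)
Definition holomorphic_disc F :=
  forall z, `|z| < 1 -> derivable (F : R[i]^o -> R[i]^o) z 1.

Definition taylor_coef phi (n : nat) : R[i] :=
  derive1n n (phi : R[i]^o -> R[i]^o) 0 / n`!%:R.

Definition dyadic_block phi (j : nat) z : R[i] :=
  \sum_(2 ^ j <= n < 2 ^ j.+1) taylor_coef phi n * z ^+ n.

Definition column_fun phi (p' : R) (j : nat) z : R[i] :=
  (2 `^ (- (j%:R / p')))%:C * dyadic_block phi j z.

End disc.

(* A space of functions together with its (possibly infinite) norm; functions
   on the circle are not quotiented by almost everywhere equality. *)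
Record fspace (R : realType) := FSpace {
  fcarrier :> Type;
  fmem : set fcarrier;
  fnorm : fcarrier -> \bar R }.
Arguments fmem {R} X _ : rename.
Arguments fnorm {R} X _ : rename.

Section spaces.
Variable R : realType.

Definition circle_Lnorm (u : R) (f : circle R -> R[i]) : \bar R :=
  Lnorm haar u%:E (fun z => (cabs (f z))%:E).

Definition seq_Lnorm (u : R) (a : nat -> \bar R) : \bar R :=
  Lnorm counting u%:E a.

Definition Lspace_circle (u : R) : fspace R :=
  @FSpace R (circle R -> R[i])
    [set f | cmeasurable f /\ (circle_Lnorm u f < +oo)%E]
    (circle_Lnorm u).

Definition little_ell (u : R) : fspace R :=
  @FSpace R (nat -> R[i])
    [set b | (seq_Lnorm u (fun j => (cabs (b j))%:E) < +oo)%E]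
    (fun b => seq_Lnorm u (fun j => (cabs (b j))%:E)).

Definition hardy_disc (u : R) (F : R[i] -> R[i]) :=
  holomorphic_disc F /\
  exists M : R, forall rho : R, 0 <= rho < 1 ->
    (\int[haar]_z ((cabs (F (rho%:C * (z : circle R)))) `^ u)%:E <= M%:E)%E.

Definition radial_boundary_function (F : R[i] -> R[i]) (f : circle R -> R[i]) :=
  {ae haar, forall z : circle R,
    (F (rho%:C * z) : R[i]^o) @[rho --> 1^'-] --> (f z : R[i]^o)}.

(* H^u identified with its boundary functions, hence with the norm of L^u(T),
   which equals the supremum of the u-means over circles of radius < 1. *)
Definition Hardy_space (u : R) : fspace R :=
  @FSpace R (circle R -> R[i])
    [set f | cmeasurable f /\
       exists2 F, hardy_disc u F & radial_boundary_function F f]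
    (circle_Lnorm u).

Definition ell_Hardy2 (t : R) : fspace R :=
  @FSpace R (nat -> circle R -> R[i])
    [set v | (forall j, fmem (Hardy_space 2) (v j)) /\
       (seq_Lnorm t (fun j => circle_Lnorm 2 (v j)) < +oo)%E]
    (fun v => seq_Lnorm t (fun j => circle_Lnorm 2 (v j))).

End spaces.

Section operators.
Variable R : realType.

(* Operators are given by their graphs, as the positive column operator is only
   defined where its series converges; boundedness includes being everywhere
   defined on X. *)
Definition op_bound (X Y : fspace R) (A : X -> Y -> Prop) (K : R) :=
  0 <= K /\ forall x, fmem X x ->
    exists y, [/\ A x y, fmem Y y & (fnorm Y y <= K%:E * fnorm X x)%E].

Definition op_bounded (X Y : fspace R) (A : X -> Y -> Prop) :=
  exists K, op_bound A K.

(* The least bound, and +oo for an unbounded operator. *)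
Definition op_norm (X Y : fspace R) (A : X -> Y -> Prop) : \bar R :=
  ereal_inf [set K%:E | K in op_bound A].

Definition positive_column (phi : R[i] -> R[i]) (p' : R) :
    (nat -> R[i]) -> (circle R -> R[i]) -> Prop :=
  fun b f => {ae haar, forall z : circle R,
    ((\sum_(0 <= j < n) b j * `|column_fun phi p' j z| ^+ 2 : R[i]^o)
       @[n --> \oo] --> (f z : R[i]^o))}.

Definition column (phi : R[i] -> R[i]) (p' : R) :
    (circle R -> R[i]) -> (nat -> circle R -> R[i]) -> Prop :=
  fun h v => v = fun j z => column_fun phi p' j z * h z.

End operators.

Arguments op_bounded {R} X Y A.
Arguments op_norm {R} X Y A.

(* Main.v *)
Require Import Defs.
From mathcomp Require Import all_boot all_order all_algebra.
From mathcomp Require Import all_classical all_reals all_analysis.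
From mathcomp Require Import measurable_realfun complex ring lra.

Set Implicit Arguments.
Unset Strict Implicit.
Unset Printing Implicit Defensive.

Import Order.TTheory GRing.Theory Num.Theory.
Import numFieldNormedType.Exports.

Local Open Scope classical_set_scope.
Local Open Scope ring_scope.

(** The column operator and the positive operator are tied by duality. Put
    q = p / (p - 2), so that t = 2 q and q is the conjugate exponent of r. For h
    in H^t,

      ||C h||^2 = || (int |X_j|^2 |h|^2)_j ||_(l^q),  || h ||_t^2 = || |h|^2 ||_q,

    so ||C||^2 is the norm of the map v |-> (int |X_j|^2 v)_j from L^q to l^q,
    tested on the weights v = |h|^2 only. This map is the adjoint of P, and both
    are positive operators. Thus K is a bound of C exactly when K^2 is a bound of
    P ([column_opP], [positive_op_boundP], [positive_bound_columnP]), and the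
    equality of norms is the equality of the least bounds ([ereal_inf_sqr]).

    A bound of P yields the bound of the adjoint at every weight, by testing
    against the extremal sequence ([column_of_positive]).

    For the converse the adjoint must be tested at the weight G^(r-1), where
    G = sum b_j |X_j|^2 is a finite sum with nonnegative coefficients, and this
    weight has to be the squared modulus of a Hardy function. Instead of
    constructing an outer function, one approximates. By the Weierstrass theorem
    ([weierstrass01]) there is a real polynomial Q such that Q(G) is uniformly
    close to G^((r-1)/2) from above. The X_j are polynomials in z, so Q(G) is a
    trigonometric polynomial, and z^N Q(G) is an analytic polynomial for N
    large: it lies in H^t and has the modulus of Q(G) ([trig_poly_hardy]).
    Letting the error tend to 0 gives the bound for G ([positive_of_column]);
    infinite complex sequences follow by monotone convergence and Fatou's
    lemma. *)

(** * Bernstein polynomials and the Weierstrass theorem *)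

Section bernstein.
Variable R : realType.
Implicit Types (f g : R -> R) (u v : nat -> R) (x y e : R) (n : nat).

(** The Bernstein polynomial of degree n with samples u, by de Casteljau's
    recursion. Its value at x is the mean of u(S) for a binomial variable S of
    parameters n and x, conditioned on one of the n trials: positivity and the
    variance become plain inductions, without binomial coefficients. *)
Fixpoint bernstein n u : {poly R} :=
  if n is m.+1 then
    'X * bernstein m (fun k => u k.+1) + (1 - 'X) * bernstein m u
  else (u 0%N)%:P.

Lemma bernsteinS n u x : (bernstein n.+1 u).[x] =
  x * (bernstein n (fun k => u k.+1)).[x] + (1 - x) * (bernstein n u).[x].
Proof. by rewrite /= hornerD !hornerM hornerD hornerN hornerX hornerC. Qed.

Lemma bernstein_le n u v x : 0 <= x <= 1 ->
  (forall k, (k <= n)%N -> u k <= v k) ->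
  (bernstein n u).[x] <= (bernstein n v).[x].
Proof.
move=> /andP[x0 x1]; elim: n u v => [|n IH] u v uv.
  by rewrite !hornerC uv.
rewrite !bernsteinS lerD// ler_wpM2l ?subr_ge0//; apply: IH => k kn; apply: uv => //.
exact: leqW.
Qed.

Lemma bernstein_affine n u a b x :
  (bernstein n (fun k => a + b * u k)).[x] = a + b * (bernstein n u).[x].
Proof. by elim: n u => [|n IH] u; rewrite ?hornerC// !bernsteinS !IH; ring. Qed.

(** The mean square deviation from a splits into the binomial variance
    n x (1 - x) and the square of the bias n x - a. The centre a is kept
    arbitrary because conditioning on one trial shifts it. *)
Lemma bernstein_variance n a x :
  (bernstein n (fun k => (k%:R - a) ^+ 2)).[x] =
    n%:R * x * (1 - x) + (n%:R * x - a) ^+ 2.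
Proof.
elim: n a => [|n IH] a; first by rewrite hornerC; ring.
rewrite bernsteinS IH.
rewrite (_ : (fun k => _) = (fun k : nat => (k%:R - (a - 1)) ^+ 2)); last first.
  by apply/funext => k; rewrite -natr1; ring.
by rewrite IH -natr1; ring.
Qed.

(** The property that every y near x satisfies the estimate holds
    locally around each x, uniformly for all small d; compactness of the
    interval then provides one d for all x. *)
Lemma heine_cantor01 f e : continuous f -> 0 < e ->
  exists2 d, 0 < d & forall x y, 0 <= x <= 1 -> 0 <= y <= 1 ->
    `|x - y| < d -> `|f x - f y| < e.
Proof.
move=> cf e0.
have : compact `[0 : R, 1] by exact: segment_compact.
move/compact_near_coveringP => /(_ R (0^'+)
  (fun d x => forall y, `|x - y| < d -> `|f x - f y| < e) _).
case.
- move=> x _.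
  have /cvgrPdist_lt/(_ (e / 2)) := cf x.
  rewrite divr_gt0// => /(_ isT) /nbhs_ballP[/= d d0 xd].
  exists (ball x (d / 2), [set i | 0 < i < d / 2]).
    split => /=; first by apply: nbhsx_ballx; rewrite divr_gt0.
    by near=> i; apply/andP; split; near: i;
      [exact: nbhs_right_gt|apply: nbhs_right_lt; rewrite divr_gt0].
  move=> [x' i] /= [xx' /andP[i0 id]] y x'y.
  have h1 : `|x - x'| < d -> `|f x - f x'| < e / 2 := xd x'.
  have h2 : `|x - y| < d -> `|f x - f y| < e / 2 := xd y.
  move: xx'; rewrite /ball/= => xx'.
  have {}h1 : `|f x - f x'| < e / 2.
    apply: h1; lra.
  have {}h2 : `|f x - f y| < e / 2.
    apply: h2.
    have := ler_distD x' x y; lra.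
  have := ler_distD (f x) (f x') (f y); rewrite (distrC (f x') (f x)); lra.
- move=> d /= d0 H.
  exists (d / 2); first by rewrite divr_gt0.
  move=> x y x01 _; apply: (H (d / 2)) => //=.
  + rewrite sub0r normrN gtr0_norm ?divr_gt0// ltr_pdivrMr// ltr_pMr//; lra.
  + by rewrite divr_gt0.
Unshelve. all: by end_near.
Qed.

(** Chebyshev's argument: uniform continuity bounds the oscillation of f by
    e / 2 + C (y - x)^2, and the Bernstein mean of the square (k / n - x)^2 is
    at most 1 / n. *)
Theorem weierstrass01 f e : continuous f -> 0 < e ->
  exists P : {poly R}, forall x, 0 <= x <= 1 -> `|f x - P.[x]| <= e.
Proof.
move=> cf e0.
have e20 : 0 < e / 2 by rewrite divr_gt0.
have [d d0 fd] := heine_cantor01 cf e20.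
have [M M0 fM] : exists2 M, 0 < M & forall x, 0 <= x <= 1 -> `|f x| <= M.
  have : compact (f @` `[0 : R, 1]).
    apply: continuous_compact; last exact: segment_compact.
    exact: continuous_subspaceT.
  move=> /compact_bounded[N [_ HN]].
  exists (`|N| + 1); first by rewrite ltr_pwDr.
  move=> x x01; apply: (HN (`|N| + 1)).
    by rewrite (le_lt_trans (ler_norm _))// ltrDl.
  by exists x => //=; rewrite in_itv.
pose C := 2 * M / d ^+ 2.
have C0 : 0 < C by rewrite divr_gt0 ?exprn_gt0 ?mulr_gt0.
have fC x y : 0 <= x <= 1 -> 0 <= y <= 1 ->
    `|f x - f y| <= e / 2 + C * (y - x) ^+ 2.
  move=> x01 y01; have [xyd|xyd] := ltP `|x - y| d.
    rewrite (le_trans (ltW (fd _ _ x01 y01 xyd)))// lerDl mulr_ge0 ?sqr_ge0//.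
    exact: ltW.
  rewrite (le_trans (ler_normB _ _))//.
  rewrite (le_trans (lerD (fM _ x01) (fM _ y01)))//.
  have : 1 <= (y - x) ^+ 2 / d ^+ 2.
    rewrite ler_pdivlMr ?exprn_gt0// mul1r -[X in _ <= X]real_normK ?num_real// distrC.
    by rewrite ler_pXn2r ?nnegrE// ltW.
  move=> h; have := ler_wpM2l (ltW (mulr_gt0 (ltr0Sn R 1) M0)) h.
  rewrite (_ : C * (y - x) ^+ 2 = 2 * M * ((y - x) ^+ 2 / d ^+ 2)).
    by lra.
  by rewrite /C; field; rewrite gt_eqF.
pose n := (Num.truncn (C / (e / 2))).+1.
have nC : C / n%:R <= e / 2.
  rewrite ler_pdivrMr ?ltr0n// mulrC -ler_pdivrMr// ltW//.
  exact: truncnS_gt.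
have n0 : (n%:R : R) != 0 by rewrite pnatr_eq0.
exists (bernstein n (fun k => f (k%:R / n%:R))) => x x01.
have key : (bernstein n (fun k => (e / 2) + C / n%:R ^+ 2 * (k%:R - n%:R * x) ^+ 2)).[x]
    <= e.
  rewrite bernstein_affine bernstein_variance subrr expr0n/= addr0.
  have : x * (1 - x) <= 1 by nra.
  move=> h; have := ler_wpM2l (ltW (divr_gt0 C0 (ltr0Sn _ _ : 0 < n%:R))) h.
  rewrite (_ : C / n%:R ^+ 2 * (n%:R * x * (1 - x)) = C / n%:R * (x * (1 - x))); last by field.
  lra.
have k01 k : (k <= n)%N -> 0 <= (k%:R / n%:R : R) <= 1.
  move=> kn; rewrite divr_ge0//= ler_pdivrMr ?ltr0n// mul1r ler_nat//.
have fk k : (k <= n)%N -> `|f x - f (k%:R / n%:R)| <=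
    e / 2 + C / n%:R ^+ 2 * (k%:R - n%:R * x) ^+ 2.
  move=> kn; apply: le_trans (fC _ _ x01 (k01 _ kn)) _.
  by rewrite le_eqVlt; apply/orP; left; apply/eqP; field.
set B := bernstein n _.
have E1 : (bernstein n (fun k => f x + (-1) * f (k%:R / n%:R))).[x] = f x - B.[x].
  by rewrite bernstein_affine mulN1r.
have E2 : (bernstein n (fun k => - f x + 1 * f (k%:R / n%:R))).[x] = - f x + B.[x].
  by rewrite bernstein_affine mul1r.
rewrite ler_norml; apply/andP; split.
  rewrite lerNl opprB addrC -E2 (le_trans _ key)//; apply: bernstein_le => // k kn.
  by rewrite mul1r addrC (le_trans _ (fk k kn))// distrC ler_norm.
rewrite -E1 (le_trans _ key)//; apply: bernstein_le => // k kn.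
by rewrite mulN1r (le_trans _ (fk k kn))// ler_norm.
Qed.

End bernstein.

(** * Powers and classical inequalities *)

Section powers.
Variable R : realType.
Implicit Types (x y s : R).

Lemma continuous_norm_powR s : 0 < s -> continuous (fun x => `|x| `^ s).
Proof.
move=> s0 x.
have [->|x0] := eqVneq x 0.
  apply/cvgrPdist_lt => e e0; rewrite normr0 powR0 ?gt_eqF//.
  have d0 : 0 < e `^ s^-1 by exact: powR_gt0.
  apply/nbhs_ballP; exists (e `^ s^-1) => //= y.
  rewrite /ball/= !sub0r !normrN => yd; rewrite ger0_norm ?powR_ge0//.
  rewrite -[ltRHS](@powRr1 _ e) ?ltW// -(mulVf (lt0r_neq0 s0)) powRrM.
  by rewrite gt0_ltr_powR ?nnegrE ?powR_ge0.
apply: (@continuous_comp R^o R^o R^o (fun x => `|x|) (fun x => x `^ s) x).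
  exact: norm_continuous.
apply: differentiable_continuous; apply/derivable1_diffP.
by apply: derivable_powR; rewrite in_itv/= andbT normr_gt0.
Qed.

Lemma eseries_trunc (F : nat -> \bar R) n :
  (\sum_(k <oo) (if (k < n)%N then F k else 0) = \sum_(k < n) F k)%E.
Proof.
apply: lim_near_cst => //.
near=> m.
have nm : (n <= m)%N by near: m; exact: nbhs_infty_ge.
rewrite (big_cat_nat (leq0n n) nm)//= [X in (_ + X)%E]big1_seq ?adde0; last first.
  by move=> i /andP[_]; rewrite mem_index_iota => /andP[ni _]; rewrite ltnNge ni.
by rewrite big_mkord; apply: eq_bigr => i _; rewrite ltn_ord.
Unshelve. all: by end_near. Qed.

(** In a duality argument the quantity x to be bounded reappears on the right
    with the exponent 1 / q < 1; cancelling that power leaves x^(1/r) <= L. *)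
Lemma self_improve x L r q : 0 < r -> 0 < q -> r^-1 + q^-1 = 1 ->
  0 <= x -> 0 <= L -> x <= L * x `^ q^-1 -> x <= L `^ r.
Proof.
move=> r0 q0 rq; rewrite le_eqVlt => /predU1P[<-|x0] L0 xL; first exact: powR_ge0.
have xE : x = x `^ r^-1 * x `^ q^-1.
  by rewrite -powRD ?rq ?powRr1 ?ltW// gt_eqF// implybT.
have h : x `^ r^-1 <= L by rewrite -(ler_pM2r (powR_gt0 q^-1 x0)) -xE.
have := @ge0_ler_powR _ r (ltW r0) _ _ (powR_ge0 _ _) L0 h.
by rewrite -powRrM mulVf ?powRr1 ?gt_eqF// ltW.
Qed.

(** Removes the error e of an approximation, by continuity of the square. *)
Lemma squeeze_square x a y : 0 <= a -> 0 <= x ->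
  (forall e, 0 < e -> y <= a * (x + e) ^+ 2) -> y <= a * x ^+ 2.
Proof.
move=> a0 x0 H; apply/ler_addgt0Pr => e e0.
pose D := a * (2 * x + 1) + 1.
have D0 : 0 < D by rewrite ltr_wpDl// mulr_ge0// addr_ge0// mulr_ge0.
pose f := Num.min 1 (e / D).
have f0 : 0 < f by rewrite lt_min ltr01 divr_gt0.
have f1 : f <= 1 by rewrite ge_min lexx.
have fD : f * D <= e by rewrite -ler_pdivlMr// ge_min lexx orbT.
have aff : a * (f * f) <= a * f by rewrite ler_wpM2l// ger_pMl.
apply: le_trans (H f f0) _; move: fD; rewrite /D; nra.
Qed.

End powers.

Section holder.
Context d (T : measurableType d) (R : realType) (mu : {measure set T -> \bar R}).
Implicit Types (f g : T -> R).

Lemma Lnorm_ge0E f s : (forall x, 0 <= f x) ->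
  Lnorm mu s%:E (EFin \o f) = ((\int[mu]_x (f x `^ s)%:E) `^ s^-1)%E.
Proof.
move=> f0; rewrite unlock; congr (_ `^ _)%E; apply: eq_integral => x _ /=.
by rewrite ger0_norm.
Qed.

Lemma holder_ge0 f g r q : measurable_fun setT f -> measurable_fun setT g ->
  (forall x, 0 <= f x) -> (forall x, 0 <= g x) ->
  0 < r -> 0 < q -> r^-1 + q^-1 = 1 ->
  (\int[mu]_x (f x * g x)%:E <=
    (\int[mu]_x (f x `^ r)%:E) `^ r^-1 * (\int[mu]_x (g x `^ q)%:E) `^ q^-1)%E.
Proof.
move=> mf mg f0 g0 r0 q0 rq.
have := hoelder mu mf mg r0 q0 rq.
rewrite Lnorm1 !Lnorm_ge0E//; apply: le_trans.
rewrite le_eqVlt; apply/orP; left; apply/eqP; apply: eq_integral => x _ /=.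
by rewrite ger0_norm// mulr_ge0.
Qed.

End holder.

Section finite_holder.
Variable R : realType.

(** The integral inequality for the counting measure, applied to sequences
    truncated at n. *)
Lemma holder_sum (b c : nat -> R) n r q :
  (forall j, 0 <= b j) -> (forall j, 0 <= c j) ->
  0 < r -> 0 < q -> r^-1 + q^-1 = 1 ->
  \sum_(j < n) b j * c j <=
    (\sum_(j < n) b j `^ r) `^ r^-1 * (\sum_(j < n) c j `^ q) `^ q^-1.
Proof.
move=> b0 c0 r0 q0 rq.
pose tr (u : nat -> R) j := if (j < n)%N then u j else 0.
have tr0 u : (forall j, 0 <= u j) -> forall j, 0 <= tr u j.
  by move=> u0 j; rewrite /tr; case: ifP.
have trS (u v : nat -> R) : (forall j, 0 <= u j) ->
    (forall j, v j = tr u j) ->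
    (\int[counting]_j (v j)%:E = (\sum_(j < n) u j)%:E)%E.
  move=> u0 uv; rewrite ge0_integral_count; last first.
    by move=> k; rewrite uv lee_fin tr0.
  rewrite -sumEFin -(eseries_trunc (fun j => (u j)%:E)); congr (limn _); apply/funext => m.
  by apply: eq_bigr => i _; rewrite uv /tr; case: ifP.
have trM u s : 0 < s -> (fun j => tr u j `^ s) = tr (fun j => u j `^ s).
  by move=> s0; apply/funext => j; rewrite /tr; case: ifP; rewrite ?powR0 ?gt_eqF.
have := @holder_ge0 _ _ R counting (tr b) (tr c) r q _ _ (tr0 _ b0) (tr0 _ c0) r0 q0 rq.
have mt u : measurable_fun setT (tr u) by [].
move=> /(_ (mt _) (mt _)).
rewrite (trS (fun j => b j * c j)); last 2 first.
  by move=> j; rewrite mulr_ge0.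
  by move=> j; rewrite /tr; case: ifP; rewrite ?mulr0.
rewrite (trS (fun j => b j `^ r)); last 2 first.
  by move=> j; rewrite powR_ge0.
  by move=> j; rewrite -trM.
rewrite (trS (fun j => c j `^ q)); last 2 first.
  by move=> j; rewrite powR_ge0.
  by move=> j; rewrite -trM.
by rewrite lee_fin.
Qed.

End finite_holder.

Section probability.
Context d (T : measurableType d) (R : realType) (mu : probability T R).

Lemma integral_le_bound (f : T -> R) (M : R) : measurable_fun setT f ->
  (forall z, 0 <= f z) -> (forall z, f z <= M) ->
  (\int[mu]_z (f z)%:E <= M%:E)%E.
Proof.
move=> mf f0 fM.
rewrite -[leRHS]mule1 -(@probability_setT _ _ _ mu) -integral_cst//.
apply: ge0_le_integral => //=.
- by move=> z _; rewrite lee_fin.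
- exact/measurable_EFinP.
- by move=> z _; rewrite lee_fin.
Qed.

Lemma integral_bounded_fin (f : T -> R) (M : R) : measurable_fun setT f ->
  (forall z, 0 <= f z) -> (forall z, f z <= M) ->
  (\int[mu]_z (f z)%:E \is a fin_num)%E.
Proof.
move=> mf f0 fM; rewrite ge0_fin_numE; last first.
  by apply: integral_ge0 => z _; rewrite lee_fin.
exact: le_lt_trans (integral_le_bound mf f0 fM) (ltry M).
Qed.

Lemma integral_powR_ge0 (f : T -> R) (s : R) : (0 <= \int[mu]_z (f z `^ s)%:E)%E.
Proof. by apply: integral_ge0 => z _; rewrite lee_fin powR_ge0. Qed.

End probability.

Section fatou_bound.
Context d (T : measurableType d) (R : realType) (mu : {measure set T -> \bar R}).

(** Fatou's lemma in the form needed for boundary values of Hardy functions and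
    for series of functions: an integral bound survives an almost everywhere
    limit. *)
Lemma fatou_ae_bound (u : nat -> T -> R) (f : T -> R) (M : \bar R) :
  (forall n, measurable_fun setT (u n)) -> measurable_fun setT f ->
  (forall n x, 0 <= u n x) ->
  {ae mu, forall x, u n x @[n --> \oo] --> f x} ->
  (forall n, \int[mu]_x (u n x)%:E <= M)%E ->
  (\int[mu]_x (f x)%:E <= M)%E.
Proof.
move=> mu_ mf u0 uf uM.
have mun n : measurable_fun setT (fun x => (u n x)%:E) by exact/measurable_EFinP.
rewrite (ae_eq_integral (fun x => limn_einf (fun n => (u n x)%:E))) //.
- apply: le_trans (fatou mu measurableT mun _) _.
    by move=> n x _; rewrite lee_fin.
  rewrite limn_einf_lim; apply: lime_le; first exact: is_cvg_einfs.
  by apply: nearW => n; apply: le_trans (uM n); apply: ereal_inf_lbound; exists n => /=.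
- exact/measurable_EFinP.
- rewrite (_ : (fun x => _) = (fun x => limn (einfs (fun n => (u n x)%:E)))); last first.
    by apply/funext => x; rewrite limn_einf_lim.
  apply: (@emeasurable_fun_cvg _ _ _ _ (fun n x => einfs (fun m => (u m x)%:E) n)).
    by move=> n; exact: (measurable_fun_einfs mun n).
  by move=> x _; exact: is_cvg_einfs.
- apply: filterS uf => x ux _.
  have uxE : (u n x)%:E @[n --> \oo] --> (f x)%:E by apply: cvg_EFin; [exact: nearW|].
  by rewrite (cvg_limn_einf_sup uxE).
Qed.

End fatou_bound.


(** * Duality for a positive operator on a probability space *)

Section duality.
Context d (T : measurableType d) (R : realType) (mu : probability T R).
Variables (A : nat -> T -> R).
Hypotheses (mA : forall j, measurable_fun setT (A j)) (A0 : forall j z, 0 <= A j z).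
Hypothesis (Abd : forall j, exists M, forall z, A j z <= M).
Implicit Types (b : nat -> R) (n : nat) (w : T -> R) (L r q : R).

Definition weighted_sum b n z := \sum_(j < n) b j * A j z.

(** The operator b |-> sum b_j A_j has norm at most L from l^r to L^r(mu). Only
    finite nonnegative sums are tested; powers are used instead of norms. *)
Definition positive_bound r L := forall n b, (forall j, 0 <= b j) ->
  (\int[mu]_z (weighted_sum b n z `^ r)%:E <= (L `^ r * \sum_(j < n) b j `^ r)%:E)%E.

(** With v = w^2, the adjoint v |-> (int A_j v)_j satisfies the bound L from
    L^q(mu) to l^q at v. The weight is written as a square because it will be
    the squared modulus of a Hardy function. *)
Definition column_bound q L w := forall n,
  (\sum_(j < n) (\int[mu]_z (A j z * w z ^+ 2)%:E) `^ q <=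
    (L `^ q)%:E * \int[mu]_z (w z `^ (2 * q))%:E)%E.

Lemma measurable_weighted_sum b n : measurable_fun setT (weighted_sum b n).
Proof. by apply: measurable_sum => j; exact: measurable_funM. Qed.

Lemma weighted_sum_ge0 b n z : (forall j, 0 <= b j) -> 0 <= weighted_sum b n z.
Proof. by move=> b0; apply: sumr_ge0 => j _; rewrite mulr_ge0. Qed.

Lemma weighted_sum_bounded b n : (forall j, 0 <= b j) ->
  exists2 M, 0 < M & forall z, weighted_sum b n z <= M.
Proof.
move=> b0; have [M AM] := choice Abd.
exists (1 + \sum_(j < n) b j * `|M j|).
  by rewrite ltr_pwDl// sumr_ge0// => j _; rewrite mulr_ge0.
move=> z; rewrite ler_wpDl//; apply: ler_sum => j _.
by rewrite ler_wpM2l// (le_trans (AM j z))// ler_norm.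
Qed.

Lemma integral_weighted_sum b n w : (forall j, 0 <= b j) -> (forall z, 0 <= w z) ->
  measurable_fun setT w ->
  (\int[mu]_z (weighted_sum b n z * w z)%:E =
    \sum_(j < n) (b j)%:E * \int[mu]_z (A j z * w z)%:E)%E.
Proof.
move=> b0 w0 mw.
have mAw j : measurable_fun setT (fun z => (A j z * w z)%:E).
  by apply/measurable_EFinP; exact: measurable_funM.
transitivity (\int[mu]_z (\sum_(j < n) (b j)%:E * (A j z * w z)%:E))%E.
  apply: eq_integral => z _; rewrite /weighted_sum mulr_suml -sumEFin.
  by apply: eq_bigr => j _; rewrite -mulrA EFinM.
rewrite ge0_integral_sum//; last 2 first.
- by move=> j; exact: measurable_funeM.
- by move=> j z _; rewrite mule_ge0// lee_fin// mulr_ge0.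
apply: eq_bigr => j _; rewrite ge0_integralZl_EFin//.
by move=> z _; rewrite lee_fin mulr_ge0.
Qed.

(** The l^q norm of c_j = int A_j w^2 is tested against its extremal dual
    sequence b_j = c_j^(q-1), for which both sum b_j c_j and sum b_j^r are
    equal to sum c_j^q; Hölder's inequality moves the test to the space. *)
Lemma column_of_positive r q L w : 0 < r -> 0 < q -> r^-1 + q^-1 = 1 -> 0 <= L ->
  (forall z, 0 <= w z) -> measurable_fun setT w ->
  (\int[mu]_z (w z `^ (2 * q))%:E < +oo)%E ->
  positive_bound r L -> column_bound q L w.
Proof.
move=> r0 q0 rq L0 w0 mw wfin PB n.
have mw2 : measurable_fun setT (fun z => w z ^+ 2) by exact: measurable_funX.
have w20 z : 0 <= w z ^+ 2 by rewrite sqr_ge0.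
have w2q z : w z `^ (2 * q) = (w z ^+ 2) `^ q.
  by rewrite powRrM powR_mulrn.
set W := (\int[mu]_z _)%E in wfin *.
have WE : W = (\int[mu]_z ((w z ^+ 2) `^ q)%:E)%E.
  by apply: eq_integral => z _; rewrite w2q.
have W0 : (0 <= W)%E by exact: integral_powR_ge0.
clearbody W.
have Wfin : W \is a fin_num by rewrite ge0_fin_numE.
have fW0 : 0 <= fine W by rewrite fine_ge0.
have cfin j : (\int[mu]_z (A j z * w z ^+ 2)%:E \is a fin_num)%E.
  rewrite ge0_fin_numE; last first.
    by apply: integral_ge0 => z _; rewrite lee_fin mulr_ge0.
  apply: le_lt_trans (holder_ge0 mu (mA j) mw2 (A0 j) w20 r0 q0 rq) _.
  rewrite -WE lte_mul_pinfty ?poweR_ge0//; last by rewrite poweR_lty.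
  have [M AM] := Abd j.
  apply: fin_num_poweR; apply: (@integral_bounded_fin _ _ _ mu _ (`|M| `^ r)).
  - by apply: (@measurableT_comp _ _ _ _ _ _ (@powR R ^~ r)).
  - by move=> z; exact: powR_ge0.
  - move=> z; apply: ge0_ler_powR; rewrite ?nnegrE//; first exact: ltW.
    by rewrite (le_trans (AM z))// ler_norm.
pose c j := fine (\int[mu]_z (A j z * w z ^+ 2)%:E)%E.
have cE j : (\int[mu]_z (A j z * w z ^+ 2)%:E = (c j)%:E)%E by rewrite fineK.
have c0 j : 0 <= c j.
  by rewrite fine_ge0// integral_ge0// => z _; rewrite lee_fin mulr_ge0.
under eq_bigr do rewrite cE poweR_EFin.
rewrite sumEFin -(fineK Wfin) -EFinM lee_fin.
set S := (X in X <= _).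
have S0 : 0 <= S by apply: sumr_ge0 => j _; exact: powR_ge0.
have br : (q - 1) * r = q.
  have : q + r = q * r.
    by rewrite -[RHS]mulr1 -rq; field; rewrite !gt_eqF.
  by move=> h; lra.
pose b j := c j `^ (q - 1).
have b0 j : 0 <= b j by exact: powR_ge0.
have bc j : b j * c j = c j `^ q by rewrite mulrC mulr_powRB1.
have bbr j : b j `^ r = c j `^ q by rewrite -powRrM br.
have h1 : S <= (L * (fine W) `^ q^-1) * S `^ r^-1.
  have SE : (S%:E = \int[mu]_z (weighted_sum b n z * w z ^+ 2)%:E)%E.
    rewrite integral_weighted_sum// -sumEFin; apply: eq_bigr => j _.
    by rewrite cE -EFinM bc.
  rewrite -lee_fin SE.
  have G0 z : 0 <= weighted_sum b n z by exact: weighted_sum_ge0.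
  apply: le_trans (holder_ge0 mu (measurable_weighted_sum b n) mw2 G0 w20 r0 q0 rq) _.
  rewrite -WE -(fineK Wfin) poweR_EFin.
  rewrite (_ : L * _ * _ = (L `^ r * S) `^ r^-1 * fine W `^ q^-1); last first.
    rewrite powRM ?powR_ge0// -powRrM divff ?gt_eqF// powRr1//; ring.
  rewrite [leRHS]EFinM lee_wpmul2r ?lee_fin ?powR_ge0//.
  rewrite -poweR_EFin; apply: gt0_ler_poweR.
  - by rewrite invr_ge0 ltW.
  - by rewrite in_itv/= leey andbT integral_powR_ge0.
  - by rewrite in_itv/= leey andbT lee_fin mulr_ge0 ?powR_ge0.
  have := PB n b b0; under [X in _ * X]eq_bigr do rewrite bbr.
  exact.
have := self_improve q0 r0 _ S0 (mulr_ge0 L0 (powR_ge0 _ _)) h1.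
rewrite addrC => /(_ rq); rewrite powRM ?powR_ge0// -powRrM mulVf ?gt_eqF// powRr1//.
Qed.

(** To bound the L^r norm of G = sum b_j A_j one would test the adjoint at the
    extremal function G^(r-1), that is at w = G^s with s = (r-1)/2. The
    hypothesis is known only for moduli of polynomials in G, so w is replaced by
    a polynomial Q(G) with G^s <= Q(G) <= G^s + e. Positivity makes the
    replacement harmless on the left, and Minkowski's inequality bounds the loss
    on the right. *)
Lemma positive_of_column r q L : 1 < r -> 1 <= q -> r^-1 + q^-1 = 1 -> 0 <= L ->
  (forall b n (Q : {poly R}), (forall j, 0 <= b j) ->
     column_bound q L (fun z => `|Q.[weighted_sum b n z]|)) ->
  positive_bound r L.
Proof.
move=> r1 q1 rq L0 CB n b b0.
have r0 : 0 < r by lra.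
have q0 : 0 < q by lra.
set G := weighted_sum b n.
have mG : measurable_fun setT G := measurable_weighted_sum b n.
have G0 z : 0 <= G z by exact: weighted_sum_ge0.
have [M M0 GM] := weighted_sum_bounded n b0.
have mpow (f : T -> R) s : measurable_fun setT f -> measurable_fun setT (fun z => f z `^ s).
  by move=> mf; apply: (@measurableT_comp _ _ _ _ _ _ (@powR R ^~ s)).
have Gfin : (\int[mu]_z (G z `^ r)%:E \is a fin_num)%E.
  apply: (@integral_bounded_fin _ _ _ mu _ (M `^ r)); first exact: mpow.
    by move=> z; exact: powR_ge0.
  by move=> z; apply: ge0_ler_powR; rewrite ?nnegrE//; exact: ltW.
have [I IE] : exists I, (\int[mu]_z (G z `^ r)%:E = I)%E by eexists.
have I0 : 0 <= fine I by rewrite -IE fine_ge0// integral_powR_ge0.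
rewrite IE in Gfin *.
pose B := (\sum_(j < n) b j `^ r) `^ r^-1.
have B0 : 0 <= B by exact: powR_ge0.
have pwle x y s : 0 <= s -> 0 <= x -> x <= y -> x `^ s <= y `^ s.
  by move=> s0 x0 xy; apply: ge0_ler_powR => //; rewrite nnegrE// (le_trans x0).
(* This s makes both G * (G ^ s) ^ 2 and (G ^ s) ^ (2 q) equal to G ^ r. *)
pose s := (r - 1) / 2.
have s0 : 0 < s by rewrite /s; lra.
have qr : (r - 1) * q = r.
  have : q + r = q * r.
    by rewrite -[RHS]mulr1 -rq; field; rewrite !gt_eqF.
  by move=> h; lra.
have s2q : s * (2 * q) = r by rewrite -[RHS]qr /s; field.
have GE z : G z `^ r = G z * (G z `^ s) ^+ 2.
  rewrite -powR_mulrn ?powR_ge0// -powRrM (_ : s * 2%:R = r - 1); last first.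
    by rewrite /s; field.
  by rewrite mulr_powRB1.
have key e : 0 < e -> fine I <= B * L * ((fine I) `^ (2 * q)^-1 + e) ^+ 2.
  move=> e0.
  have [P PM] : exists P : {poly R}, forall x, 0 <= x <= 1 ->
      `| `|M * x| `^ s - P.[x] | <= e / 2.
    apply: weierstrass01; last by rewrite divr_gt0.
    move=> x; apply: (@continuous_comp R^o R^o R^o (fun x => M * x) (fun x => `|x| `^ s) x).
      exact: mulrl_continuous.
    exact: continuous_norm_powR.
  (* The shift by e / 2 turns a two-sided error into an upper approximation. *)
  pose Q := P \Po (M^-1 *: 'X) + (e / 2)%:P.
  have QE x : Q.[x] = P.[x / M] + e / 2.
    by rewrite hornerD horner_comp hornerZ hornerX hornerC mulrC.
  have GM01 z : 0 <= G z / M <= 1.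
    by rewrite divr_ge0 ?(ltW M0)//= ler_pdivrMr// mul1r GM.
  have MGM z : M * (G z / M) = G z by rewrite mulrC divfK// gt_eqF.
  have Glo z : G z `^ s <= Q.[G z].
    have := PM _ (GM01 z).
    rewrite MGM (ger0_norm (G0 z)) ler_norml => /andP[_].
    by rewrite QE; lra.
  have Ghi z : Q.[G z] <= G z `^ s + e.
    have := PM _ (GM01 z).
    rewrite MGM (ger0_norm (G0 z)) ler_norml => /andP[+ _].
    by rewrite QE; lra.
  pose w z := `|Q.[G z]|.
  have wE z : w z = Q.[G z].
    by rewrite /w ger0_norm// (le_trans _ (Glo z))// powR_ge0.
  have w0 z : 0 <= w z by exact: normr_ge0.
  have mw : measurable_fun setT w.
    rewrite (_ : w = (fun z => Q.[G z])); last by apply/funext => z; rewrite wE.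
    apply: (@measurableT_comp _ _ _ _ _ _ (fun x => Q.[x])) => //.
    apply: continuous_measurable_fun; exact: continuous_horner.
  have mw2 : measurable_fun setT (fun z => w z ^+ 2) by exact: measurable_funX.
  have whi z : w z <= M `^ s + e.
    by rewrite wE (le_trans (Ghi z))// lerD2r pwle// ltW.
  have Me0 : 0 <= M `^ s + e by rewrite addr_ge0 ?powR_ge0// ltW.
  have cfin j : (\int[mu]_z (A j z * w z ^+ 2)%:E \is a fin_num)%E.
    have [N AN] := Abd j.
    apply: (@integral_bounded_fin _ _ _ mu _ (N * (M `^ s + e) ^+ 2)).
    - exact: measurable_funM.
    - by move=> z; rewrite mulr_ge0// sqr_ge0.
    - by move=> z; rewrite ler_pM ?sqr_ge0// ler_sqr ?nnegrE.
  pose c j := fine (\int[mu]_z (A j z * w z ^+ 2)%:E)%E.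
  have cE j : (\int[mu]_z (A j z * w z ^+ 2)%:E = (c j)%:E)%E by rewrite fineK.
  have c0 j : 0 <= c j.
    rewrite fine_ge0// integral_ge0// => z _.
    by rewrite lee_fin mulr_ge0// sqr_ge0.
  have [NE NEE] : exists N, (\int[mu]_z (w z `^ (2 * q))%:E = N)%E by eexists.
  have NE0 : (0 <= NE)%E by rewrite -NEE integral_powR_ge0.
  have Nfin : (NE \is a fin_num)%E.
    rewrite -NEE.
    apply: (@integral_bounded_fin _ _ _ mu _ ((M `^ s + e) `^ (2 * q))); first exact: mpow.
      by move=> z; exact: powR_ge0.
    by move=> z; apply: pwle => //; lra.
  have N0 : 0 <= fine NE by rewrite fine_ge0.
  have C1 : \sum_(j < n) c j `^ q <= L `^ q * fine NE.
    rewrite -lee_fin EFinM (fineK Nfin) -NEE -sumEFin; apply: le_trans (CB b n Q b0 n).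
    by rewrite le_eqVlt; apply/orP; left; apply/eqP/eq_bigr => j _; rewrite cE poweR_EFin.
  have C2 : fine NE `^ (2 * q)^-1 <= fine I `^ (2 * q)^-1 + e.
    have mGs : measurable_fun setT (fun z => G z `^ s) by exact: mpow.
    have := @minkowski_EFin _ _ _ mu (fun z => G z `^ s) (cst e) (2 * q) mGs
       (measurable_cst _).
    have q21 : 1 <= 2 * q by rewrite (le_trans q1)// ler_peMl ?ler1n// ltW.
    move=> /(_ q21).
    rewrite (_ : (fun z => G z `^ s) \+ cst e = (fun z => G z `^ s + e))//.
    have Gs0 z : 0 <= G z `^ s by exact: powR_ge0.
    have e0' : forall z : T, 0 <= cst e z by move=> z; exact: ltW.
    have Ge0 z : 0 <= G z `^ s + e by rewrite addr_ge0// ltW.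
    rewrite (Lnorm_ge0E _ _ Gs0) (Lnorm_ge0E _ _ e0') (Lnorm_ge0E _ _ Ge0).
    under [X in (_ <= X `^ _ + _)%E -> _]eq_integral do rewrite -powRrM s2q.
    rewrite IE -(fineK Gfin).
    have -> : (\int[mu]_z (cst e z `^ (2 * q))%:E = (e `^ (2 * q))%:E)%E.
      have := @integral_cst _ _ _ mu setT measurableT (e `^ (2 * q))%:E.
      by rewrite [X in (_ * X)%E](@probability_setT _ _ _ mu) mule1.
    rewrite !poweR_EFin -(powRrM e) divff ?gt_eqF ?mulr_gt0// (powRr1 (ltW e0)).
    rewrite -EFinD => h; rewrite -lee_fin -poweR_EFin (fineK Nfin); apply: le_trans h.
    apply: gt0_ler_poweR.
    - by rewrite invr_ge0 mulr_ge0 ?ltW.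
    - by rewrite in_itv/= leey andbT.
    - by rewrite in_itv/= leey andbT integral_powR_ge0.
    rewrite -NEE; apply: ge0_le_integral => //.
    - by move=> z _; rewrite lee_fin powR_ge0.
    - by apply/measurable_EFinP; exact: mpow.
    - by apply/measurable_EFinP; apply: mpow; exact: measurable_funD.
    - by move=> z _; rewrite lee_fin pwle ?wE ?Ghi// -?wE// mulr_ge0// ltW.
  have C3 : fine I <= \sum_(j < n) b j * c j.
    rewrite -lee_fin (fineK Gfin) -IE -sumEFin.
    apply: (@le_trans _ _ (\int[mu]_z (G z * w z ^+ 2)%:E)%E).
      apply: ge0_le_integral => //.
      - by move=> z _; rewrite lee_fin powR_ge0.
      - by apply/measurable_EFinP; exact: mpow.
      - by apply/measurable_EFinP; exact: measurable_funM.
      - move=> z _; rewrite lee_fin GE ler_wpM2l// ler_sqr ?nnegrE ?powR_ge0//.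
        by rewrite wE.
    rewrite integral_weighted_sum//; last by move=> z; rewrite sqr_ge0.
    by apply: lee_sum => j _; rewrite cE.
  apply: le_trans C3 _; apply: le_trans (holder_sum n b0 c0 r0 q0 rq) _.
  rewrite -/B -mulrA ler_wpM2l//.
  apply: (@le_trans _ _ (L * fine NE `^ q^-1)).
    rewrite -[X in X * _]powRr1// -(divff (lt0r_neq0 q0)) powRrM -powRM ?powR_ge0//.
    apply: pwle; [by rewrite invr_ge0 ltW| |exact: C1].
    by apply: sumr_ge0 => j _; exact: powR_ge0.
  rewrite ler_wpM2l//.
  rewrite (_ : q^-1 = (2 * q)^-1 * 2%:R); last by field; rewrite gt_eqF.
  rewrite powRrM powR_mulrn ?powR_ge0// ler_sqr ?nnegrE ?powR_ge0//.
  by rewrite addr_ge0 ?powR_ge0// ltW.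
have I2 : fine I <= B * L * fine I `^ q^-1.
  rewrite (_ : q^-1 = (2 * q)^-1 * 2%:R); last by field; rewrite gt_eqF.
  rewrite powRrM powR_mulrn ?powR_ge0//.
  by apply: squeeze_square => //; [rewrite mulr_ge0|exact: powR_ge0].
have := self_improve r0 q0 rq I0 (mulr_ge0 B0 L0) I2.
rewrite powRM// -powRrM mulVf ?gt_eqF// powRr1; last first.
  by apply: sumr_ge0 => j _; exact: powR_ge0.
by rewrite mulrC -lee_fin fineK.
Qed.

End duality.

(** * The modulus and convergence of complex numbers *)

Section complex_modulus.
Variable R : realType.
Implicit Types (z w : R[i]) (x e : R).
Local Notation C := (R[i]).

Lemma normc_cabs z : `|z| = (cabs z)%:C%C.
Proof. by rewrite /cabs normc_def. Qed.

Lemma cabsE z : cabs z = Num.sqrt (complex.Re z ^+ 2 + complex.Im z ^+ 2).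
Proof. by rewrite /cabs normc_def. Qed.

Lemma cabs_ge0 z : 0 <= cabs z. Proof. by rewrite cabsE sqrtr_ge0. Qed.

Lemma cabsM z w : cabs (z * w) = cabs z * cabs w.
Proof. by apply: complexI; rewrite rmorphM/= -!normc_cabs normrM. Qed.

Lemma cabsD z w : cabs (z + w) <= cabs z + cabs w.
Proof. by rewrite -lecR rmorphD/= -!normc_cabs ler_normD. Qed.

Lemma cabsN z : cabs (- z) = cabs z.
Proof. by apply: complexI; rewrite -!normc_cabs normrN. Qed.

Lemma cabs_distC z w : cabs (z - w) = cabs (w - z).
Proof. by rewrite -cabsN opprB. Qed.

Lemma cabs_dist z w : `|cabs z - cabs w| <= cabs (z - w).
Proof.
rewrite ler_norml; apply/andP; split.
  by have := cabsD (w - z) z; rewrite subrK cabs_distC; lra.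
by have := cabsD (z - w) w; rewrite subrK; lra.
Qed.

Lemma cabsR x : cabs x%:C%C = `|x|.
Proof. by rewrite cabsE/= expr0n/= addr0 sqrtr_sqr. Qed.

Lemma cabsX z n : cabs (z ^+ n) = cabs z ^+ n.
Proof.
elim: n => [|n IH]; first by rewrite !expr0 (cabsR 1) normr1.
by rewrite !exprS cabsM IH.
Qed.

Lemma cabs_Re z : `|complex.Re z| <= cabs z.
Proof. by rewrite cabsE -sqrtr_sqr ler_wsqrtr// lerDl sqr_ge0. Qed.

Lemma cabs_Im z : `|complex.Im z| <= cabs z.
Proof. by rewrite cabsE -sqrtr_sqr ler_wsqrtr// lerDr sqr_ge0. Qed.

Lemma cabs_le z : cabs z <= `|complex.Re z| + `|complex.Im z|.
Proof.
rewrite {1}[z]complexE; apply: le_trans (cabsD _ _) _.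
rewrite cabsM !cabsR (_ : cabs 'i%C = 1) ?mul1r//.
by rewrite cabsE/= expr0n/= add0r expr1n sqrtr1.
Qed.

Lemma norm_lt1 z : (`|z| < 1) = (cabs z < 1).
Proof. by rewrite normc_cabs (_ : 1 = 1%:C%C) ?ltcR. Qed.

Lemma cabs_circle (z : circle R) : cabs (z : C) = 1.
Proof. by apply: complexI; rewrite -normc_cabs; apply/eqP; exact: (svalP z). Qed.

(** The positive elements of R[i] are the positive reals, so the ball filter of
    R[i] is the one defined by the real-valued modulus. *)
Lemma cvgC_dist (T : Type) (F : set_system T) (FF : Filter F) (f : T -> C) (l : C) :
  (f x : C^o) @[x --> F] --> (l : C^o) <->
  forall e : R, 0 < e -> \forall x \near F, cabs (l - f x) < e.
Proof.
split=> [/cvgrPdist_lt H e e0|H].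
  have := H e%:C%C; rewrite ltcR => /(_ e0); apply: filterS => x.
  by rewrite normc_cabs ltcR.
apply/cvgrPdist_lt => e; rewrite ltcE/= => /andP[/eqP ei e0].
apply: filterS (H _ e0) => x h.
by rewrite normc_cabs ltcE/= ei eqxx.
Qed.

Lemma cvg_cabs (T : Type) (F : set_system T) (FF : Filter F) (f : T -> C) (l : C) :
  (f x : C^o) @[x --> F] --> (l : C^o) -> cabs (f x) @[x --> F] --> cabs l.
Proof.
move=> /cvgC_dist H; apply/cvgrPdist_lt => e /H; apply: filterS => x.
exact/le_lt_trans/cabs_dist.
Qed.

Lemma cvg_Re (T : Type) (F : set_system T) (FF : Filter F) (f : T -> C) (l : C) :
  (f x : C^o) @[x --> F] --> (l : C^o) -> complex.Re (f x) @[x --> F] --> complex.Re l.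
Proof.
move=> /cvgC_dist H; apply/cvgrPdist_lt => e /H; apply: filterS => x.
by apply/le_lt_trans; rewrite -raddfB cabs_Re.
Qed.

Lemma cvg_Im (T : Type) (F : set_system T) (FF : Filter F) (f : T -> C) (l : C) :
  (f x : C^o) @[x --> F] --> (l : C^o) -> complex.Im (f x) @[x --> F] --> complex.Im l.
Proof.
move=> /cvgC_dist H; apply/cvgrPdist_lt => e /H; apply: filterS => x.
by apply/le_lt_trans; rewrite -raddfB cabs_Im.
Qed.

Lemma cvgC_ReIm (T : Type) (F : set_system T) (FF : Filter F) (f : T -> C) (l : C) :
  complex.Re (f x) @[x --> F] --> complex.Re l ->
  complex.Im (f x) @[x --> F] --> complex.Im l ->
  (f x : C^o) @[x --> F] --> (l : C^o).
Proof.
move=> /cvgrPdist_lt Hr /cvgrPdist_lt Hi; apply/cvgC_dist => e e0.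
have e20 : 0 < e / 2 by rewrite divr_gt0.
near=> x; apply: le_lt_trans (cabs_le _) _.
rewrite [e]splitr !raddfB ltrD//; near: x; [exact: Hr|exact: Hi].
Unshelve. all: by end_near. Qed.

End complex_modulus.

Section complex_measurability.
Context (R : realType) d (T : measurableType d).
Local Notation C := (R[i]).
Implicit Types f g : T -> C.

Lemma cmeasurableM f g : cmeasurable f -> cmeasurable g ->
  cmeasurable (fun x => f x * g x).
Proof.
move=> [fr fi] [gr gi]; split.
- rewrite (_ : (fun x => _) = (fun x => complex.Re (f x) * complex.Re (g x) -
    complex.Im (f x) * complex.Im (g x))).
    by apply: measurable_funB; exact: measurable_funM.
  by apply/funext => x; case: (f x) (g x) => ? ? [? ?].
- rewrite (_ : (fun x => _) = (fun x => complex.Re (f x) * complex.Im (g x) +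
    complex.Im (f x) * complex.Re (g x))).
    by apply: measurable_funD; exact: measurable_funM.
  by apply/funext => x; case: (f x) (g x) => ? ? [? ?].
Qed.

Lemma measurable_cabs f : cmeasurable f -> measurable_fun setT (fun x => cabs (f x)).
Proof.
move=> [fr fi].
rewrite (_ : (fun x => _) = 
    (fun x => Num.sqrt (complex.Re (f x) ^+ 2 + complex.Im (f x) ^+ 2))).
  have ms : measurable_fun setT (@Num.sqrt R : R -> R).
    by apply: continuous_measurable_fun; exact: sqrt_continuous.
  have mf : measurable_fun setT
      (fun x => complex.Re (f x) ^+ 2 + complex.Im (f x) ^+ 2 : R).
    by apply: measurable_funD; exact: measurable_funX.
  exact: (measurableT_comp ms mf).
by apply/funext => x; rewrite cabsE.
Qed.

End complex_measurability.

(** * Measurability on the circle *)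

Section circle_measurability.
Variable R : realType.
Local Notation C := (R[i]).

Lemma measurable_reim : measurable_fun setT (@reim R : circle R -> _).
Proof.
move=> _ B mB; rewrite setTI; exists B => //; by rewrite setTI.
Qed.

Lemma measurable_circle_Re : measurable_fun setT (fun z : circle R => complex.Re (z : C)).
Proof. exact: (measurableT_comp measurable_fst measurable_reim). Qed.

Lemma measurable_circle_Im : measurable_fun setT (fun z : circle R => complex.Im (z : C)).
Proof. exact: (measurableT_comp measurable_snd measurable_reim). Qed.

Lemma measurable_acos : measurable_fun `[(-1 : R), 1] (@acos R).
Proof.
rewrite (_ : `[_, _]%classic = [set -1; 1] `|` `](-1 : R), 1[); last first.
  apply/seteqP; split => x /=; rewrite !in_itv/=.
    move=> /andP[h1 h2]; have [->|n1] := eqVneq x (-1); first by left; left.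
    have [->|n2] := eqVneq x 1; first by left; right.
    by right; rewrite !lt_neqAle eq_sym n1 h1 n2 h2.
  move=> [[->|->]|/andP[/ltW -> /ltW ->]//]; rewrite lexx ?andbT/=; lra.
apply/measurable_funU => //; first exact: measurableU.
split.
  by apply/measurable_funU => //; split; exact: measurable_fun_set1.
apply: open_continuous_measurable_fun; first exact: interval_open.
by move=> x; rewrite inE/= in_itv/= => /continuous_acos.
Qed.

Definition arg (z : circle R) : R :=
  if 0 <= complex.Im (z : C) then acos (complex.Re (z : C)) else - acos (complex.Re (z : C)).

Lemma circle_sqr (z : circle R) : complex.Re (z : C) ^+ 2 + complex.Im (z : C) ^+ 2 = 1.
Proof.
have := cabs_circle z; rewrite cabsE => h.
rewrite -[LHS]sqr_sqrtr ?h ?expr1n// addr_ge0 ?sqr_ge0//.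
Qed.

Lemma circle_Re_itv (z : circle R) : -1 <= complex.Re (z : C) <= 1.
Proof. by rewrite -ler_norml -(cabs_circle z) cabs_Re. Qed.

Lemma measurable_arg : measurable_fun setT arg.
Proof.
have macos : measurable_fun setT (fun z : circle R => acos (complex.Re (z : C))).
  apply: (@measurable_comp _ _ _ _ _ _ `[(-1 : R), 1]) => //.
  - by move=> _ [z _ <-]; rewrite /= in_itv/= circle_Re_itv.
  - exact: measurable_acos.
  - exact: measurable_circle_Re.
apply: measurable_fun_ifT => //.
- by apply: measurable_fun_ler => //; exact: measurable_circle_Im.
- exact: measurableT_comp.
Qed.

Lemma argK z : expi (arg z) = z.
Proof.
apply: val_inj => /=; rewrite /arg.
have E : sin (acos (complex.Re (z : C))) = `|complex.Im (z : C)|.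
  rewrite sin_acos ?circle_Re_itv// -sqrtr_sqr; congr Num.sqrt.
  by rewrite -(circle_sqr z); ring.
have E2 : cos (acos (complex.Re (z : C))) = complex.Re (z : C).
  by rewrite acosK// in_itv/= circle_Re_itv.
have zE : forall c : C, c = (complex.Re c +i* complex.Im c)%C by case.
rewrite [RHS]zE; case: ifPn => [im0|]; first by rewrite E E2 ger0_norm.
by rewrite -ltNge cosN sinN E E2 => im0; rewrite ltr0_norm// opprK.
Qed.

(** The exponential map has the measurable right inverse arg, so measurability
    on the circle can be tested on the real line, where continuous functions
    are measurable. *)
Lemma measurable_circle d' (U : measurableType d') (f : circle R -> U) :
  measurable_fun setT (fun x : measurableTypeR R => f (expi x)) ->
  measurable_fun setT f.
Proof.
move=> mf; rewrite (_ : f = (fun x => f (expi x)) \o arg).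
  exact: (measurableT_comp mf measurable_arg).
by apply/funext => z /=; rewrite argK.
Qed.

Lemma continuous_expi : continuous (fun x : R => (expi x : C) : C^o).
Proof.
by move=> x; apply: cvgC_ReIm => /=; [exact: continuous_cos|exact: continuous_sin].
Qed.

Lemma cmeasurable_continuous (F : C -> C) :
  (forall z : circle R, {for (z : C), continuous (F : C^o -> C^o)}) ->
  cmeasurable (fun z : circle R => F z).
Proof.
move=> cF.
have cFe x : (F (expi y) : C^o) @[y --> (x : R)] --> (F (expi x) : C^o).
  apply: (@cvg_comp _ _ _ (fun y : R => (expi y : C) : C^o) (F : C^o -> C^o)).
    exact: continuous_expi.
  exact: cF.
split; apply: measurable_circle; apply: continuous_measurable_fun => x.
  exact: cvg_Re (cFe x).
exact: cvg_Im (cFe x).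
Qed.

End circle_measurability.

(** * Hardy spaces and trigonometric polynomials *)

Section hardy.
Variable R : realType.
Local Notation C := (R[i]).
Implicit Types (F : C -> C) (u : R).

Lemma holomorphic_continuous F (z : C) : holomorphic_disc F -> cabs z < 1 ->
  {for z, continuous (F : C^o -> C^o)}.
Proof.
move=> hF z1; apply: differentiable_continuous; apply/derivable1_diffP.
by apply: hF; rewrite norm_lt1.
Qed.

Lemma cabs_rho (rho : R) (z : circle R) : 0 <= rho -> cabs (rho%:C%C * z) = rho.
Proof. by move=> r0; rewrite cabsM cabs_circle mulr1 cabsR ger0_norm. Qed.

Lemma cmeasurable_dilation F (rho : R) : holomorphic_disc F -> 0 <= rho < 1 ->
  cmeasurable (fun z : circle R => F (rho%:C%C * z)).
Proof.
move=> hF /andP[r0 r1].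
apply: (@cmeasurable_continuous _ (fun z => F (rho%:C%C * z))) => z.
apply: (@continuous_comp C^o C^o C^o (fun z => rho%:C%C * z) F z).
  exact: mulrl_continuous.
by apply: holomorphic_continuous => //; rewrite cabs_rho.
Qed.

Lemma measurable_cabs_powR d (T : measurableType d) (f : T -> C) u :
  cmeasurable f -> measurable_fun setT (fun x => cabs (f x) `^ u).
Proof.
move=> mf; apply: (@measurableT_comp _ _ _ _ _ _ (@powR R ^~ u)) => //.
exact: measurable_cabs.
Qed.

Lemma cvg_cabs_powR (f : nat -> C) (l : C) u : 0 < u ->
  (f n : C^o) @[n --> \oo] --> (l : C^o) ->
  cabs (f n) `^ u @[n --> \oo] --> cabs l `^ u.
Proof.
move=> u0 /cvg_cabs fl.
have c := @continuous_norm_powR R u u0 : forall x : R, `|y| `^ u @[y --> x] --> `|x| `^ u.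
have := cvg_comp _ _ fl (c (cabs l)).
rewrite ger0_norm ?cabs_ge0//; apply: cvg_trans; apply: near_eq_cvg.
by apply: nearW => n /=; rewrite ger0_norm ?cabs_ge0.
Qed.

Lemma radial_sequence : exists2 rho : nat -> R, (forall n, 0 <= rho n < 1) &
  rho n @[n --> \oo] --> 1^'-.
Proof.
have h0 n : 0 < harmonic n :> R by rewrite invr_gt0.
have h1 n : harmonic n <= 1 :> R by rewrite invf_le1// ler1n.
exists (fun n => 1 - harmonic n).
  by move=> n; have := h0 n; have := h1 n; lra.
have cvg1 : 1 - harmonic n @[n --> \oo] --> (1 : R).
  by rewrite -[X in _ --> X]subr0; apply: cvgB; [exact: cvg_cst|exact: cvg_harmonic].
move=> P /= H.
have : \forall n \near \oo, 1 - harmonic n < 1 :> R -> P (1 - harmonic n).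
  exact: (cvg1 _ H).
apply: filterS => n; apply.
by have := h0 n; lra.
Qed.

(** Fatou's lemma along a sequence of radii that increases to 1. *)
Lemma hardy_integral_lty u (f : circle R -> C) : 0 < u ->
  fmem (Hardy_space u) f -> (\int[haar]_z (cabs (f z) `^ u)%:E < +oo)%E.
Proof.
move=> u0 [mf [F [hF [M FM]] Ff]].
have [rho rho01 rho1] := radial_sequence.
apply: le_lt_trans (ltry M).
apply: (@fatou_ae_bound _ (circle R) R haar
  (fun n (z : circle R) => cabs (F ((rho n)%:C%C * z)) `^ u) (fun z => cabs (f z) `^ u)).
- by move=> n; apply: measurable_cabs_powR; exact: cmeasurable_dilation.
- exact: measurable_cabs_powR.
- by move=> *; exact: powR_ge0.
- apply: filterS Ff => z Fz; apply: cvg_cabs_powR => //.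
  exact: (cvg_comp _ _ rho1 Fz).
- by move=> n; exact: FM.
Qed.

Lemma cvgC_mul (I : Type) (G : set_system I) (FG : Filter G) (f g : I -> C) (a b : C) :
  (f x : C^o) @[x --> G] --> (a : C^o) -> (g x : C^o) @[x --> G] --> (b : C^o) ->
  (f x * g x : C^o) @[x --> G] --> (a * b : C^o).
Proof.
by move=> fa gb; have := @cvgM C I G FG f g a b; apply; [exact: fa|exact: gb].
Qed.

Lemma derivable_mulC (f g : C -> C) (z : C) :
  derivable (f : C^o -> C^o) z 1 -> derivable (g : C^o -> C^o) z 1 ->
  derivable ((fun x => f x * g x) : C^o -> C^o) z 1.
Proof.
by move=> df dg; have := @derivableM C C^o f g z 1; apply; [exact: df|exact: dg].
Qed.

Lemma derivable_addC (f g : C -> C) (z : C) :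
  derivable (f : C^o -> C^o) z 1 -> derivable (g : C^o -> C^o) z 1 ->
  derivable ((fun x => f x + g x) : C^o -> C^o) z 1.
Proof.
by move=> df dg; have := @derivableD C C^o C^o f g z 1; apply; [exact: df|exact: dg].
Qed.

Lemma derivable_poly (P : {poly C}) (z : C) : derivable (horner P : C^o -> C^o) z 1.
Proof.
have dc (c : C) : derivable ((fun=> c) : C^o -> C^o) z 1 by exact: derivable_cst.
elim/poly_ind: P => [|P c IH].
  rewrite (_ : horner 0 = (fun=> 0)); first exact: dc.
  by apply/funext => x; rewrite horner0.
rewrite (_ : horner _ = (fun x => P.[x] * x + c)).
  have did : derivable ((fun x => x) : C^o -> C^o) z 1 by exact: derivable_id.
  exact: (derivable_addC (derivable_mulC IH did) (dc c)).
by apply/funext => x; rewrite !hornerE.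
Qed.

Lemma continuous_poly (P : {poly C}) : continuous (horner P : C^o -> C^o).
Proof.
move=> z; apply: differentiable_continuous; apply/derivable1_diffP.
exact: derivable_poly.
Qed.

Lemma poly_bounded (P : {poly C}) :
  exists2 M, 0 <= M & forall z, cabs z <= 1 -> cabs P.[z] <= M.
Proof.
elim/poly_ind: P => [|P c [M M0 IH]].
  by exists 0 => // z _; rewrite horner0 (cabsR 0) normr0.
exists (M + cabs c); first by rewrite addr_ge0// cabs_ge0.
move=> z z1; rewrite !hornerE (le_trans (cabsD _ _))// lerD2r cabsM.
by rewrite -[M]mulr1 ler_pM ?cabs_ge0 ?IH.
Qed.

Lemma cmeasurable_poly (P : {poly C}) : cmeasurable (fun z : circle R => P.[z : C]).
Proof. by apply: cmeasurable_continuous => z; exact: continuous_poly. Qed.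

Lemma poly_radial (P : {poly C}) (z : circle R) :
  (P.[rho%:C%C * (z : C)] : C^o) @[rho --> 1^'-] --> (P.[z : C] : C^o).
Proof.
apply: (@cvg_comp _ _ _ (fun rho : R => (rho%:C%C * (z : C)) : C^o) (horner P : C^o -> C^o)).
  2: exact: continuous_poly.
apply/cvgC_dist => e e0; near=> rho.
rewrite -[X in X - _]mul1r -mulrBl cabsM cabs_circle mulr1.
rewrite (_ : 1 = 1%:C%C)// -rmorphB cabsR.
by near: rho; exists e => //= x xe _; exact: xe.
Unshelve. all: by end_near. Qed.

Lemma poly_hardy (P : {poly C}) u : 0 < u ->
  fmem (Hardy_space u) (fun z => P.[z : C]).
Proof.
move=> u0; split; first exact: cmeasurable_poly.
exists (horner P); last by apply: nearW => z; exact: poly_radial.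
split; first by move=> z _; exact: derivable_poly.
have [M M0 PM] := poly_bounded P.
exists (M `^ u) => rho rho01.
apply: integral_le_bound.
- apply: measurable_cabs_powR; apply: cmeasurable_dilation => //.
  by move=> z _; exact: derivable_poly.
- by move=> z; exact: powR_ge0.
- move=> z; apply: ge0_ler_powR; rewrite ?nnegrE ?cabs_ge0//; first exact: ltW.
  by apply: PM; case/andP: rho01 => r0 r1; rewrite cabs_rho// ltW.
Qed.

(** The factor P is bounded on the disc, and for 2 <= t the square of a modulus
    is at most 1 plus its power t, so the t-means of F control the 2-means
    of P F. *)
Lemma poly_mul_hardy2 (P : {poly C}) t (f : circle R -> C) : 2 <= t ->
  fmem (Hardy_space t) f -> fmem (Hardy_space 2) (fun z => P.[z : C] * f z).
Proof.
move=> t2 [mf [F [hF [N FN]] Ff]].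
split; first by apply: cmeasurableM => //; exact: cmeasurable_poly.
have hPF : holomorphic_disc (fun z => P.[z] * F z).
  by move=> z z1; apply: derivable_mulC; [exact: derivable_poly|exact: hF].
exists (fun z => P.[z] * F z); last first.
  have PF (z : circle R) : (F (rho%:C%C * (z : C)) : C^o) @[rho --> 1^'-] --> (f z : C^o) ->
      (P.[rho%:C%C * (z : C)] * F (rho%:C%C * (z : C)) : C^o) @[rho --> 1^'-] -->
        (P.[z : C] * f z : C^o).
    move=> Fz; exact: (@cvgC_mul _ _ _ (fun rho : R => P.[rho%:C%C * (z : C)])
      (fun rho : R => F (rho%:C%C * (z : C))) _ _ (@poly_radial P z) Fz).
  by apply: filterS Ff => z; exact: PF.
split => //.
have [M M0 PM] := poly_bounded P.
exists (M ^+ 2 * (1 + N)) => rho rho01.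
have mF := cmeasurable_dilation hF rho01.
have mFt : measurable_fun setT (fun z : circle R => (cabs (F (rho%:C%C * z)) `^ t)%:E).
  by apply/measurable_EFinP; exact: measurable_cabs_powR.
apply: (@le_trans _ _
  (\int[haar]_z ((M ^+ 2)%:E * (1 + (cabs (F (rho%:C%C * (z : circle R))) `^ t)%:E)))%E).
  apply: ge0_le_integral => //=.
  - by move=> z _; rewrite lee_fin powR_ge0.
  - apply/measurable_EFinP; apply: measurable_cabs_powR.
    exact: (@cmeasurable_dilation (fun z => P.[z] * F z)).
  - by apply: measurable_funeM; apply: emeasurable_funD.
  - move=> z _; rewrite -EFinD -EFinM lee_fin powR_mulrn ?cabs_ge0// cabsM exprMn.
    have a0 := cabs_ge0 (F (rho%:C%C * (z : circle R))).
    apply: ler_pM; rewrite ?sqr_ge0//.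
      rewrite ler_sqr ?nnegrE ?cabs_ge0//; apply: PM.
      by case/andP: rho01 => r0 r1; rewrite cabs_rho// ltW.
    have [a1|a1] := leP (cabs (F (rho%:C%C * (z : circle R)))) 1.
      by rewrite ler_wpDr ?powR_ge0// exprn_ile1.
    by rewrite ler_wpDl// -powR_mulrn// ler_powR// ltW.
rewrite ge0_integralZl_EFin ?sqr_ge0//; last 2 first.
- by move=> z _; rewrite adde_ge0// lee_fin powR_ge0.
- exact: emeasurable_funD.
rewrite [leRHS]EFinM lee_wpmul2l ?lee_fin ?sqr_ge0// ge0_integralD//; last first.
  by move=> z _; rewrite lee_fin powR_ge0.
rewrite integral_cst// [X in (_ * X + _)%E](@probability_setT _ _ _ (@haar R)).
by rewrite mule1 EFinD leeD2l// FN.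
Qed.

End hardy.

Section trigonometric.
Variable R : realType.
Local Notation C := (R[i]).
Implicit Types (f g : circle R -> C).

(** Trigonometric polynomials, encoded as the functions that a power of z
    carries to an analytic polynomial: negative frequencies are shifted away
    rather than represented. *)
Definition trig_poly f := exists N (P : {poly C}),
  forall z : circle R, (z : C) ^+ N * f z = P.[z : C].

Lemma trig_poly_horner (P : {poly C}) : trig_poly (fun z => P.[z : C]).
Proof. by exists 0%N, P => z; rewrite mul1r. Qed.

Lemma trig_polyD f g : trig_poly f -> trig_poly g -> trig_poly (fun z => f z + g z).
Proof.
move=> [N [P fP]] [M [Q gQ]]; exists (N + M)%N, ('X^M * P + 'X^N * Q) => z.
rewrite hornerD !hornerM !hornerXn -fP -gQ exprD.
by move: (circle_val z ^+ N) (circle_val z ^+ M) (f z) (g z) => x y a b; ring.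
Qed.

Lemma trig_polyM f g : trig_poly f -> trig_poly g -> trig_poly (fun z => f z * g z).
Proof.
move=> [N [P fP]] [M [Q gQ]]; exists (N + M)%N, (P * Q) => z.
rewrite hornerM -fP -gQ exprD.
by move: (circle_val z ^+ N) (circle_val z ^+ M) (f z) (g z) => x y a b; ring.
Qed.

Lemma trig_poly_cst (c : C) : trig_poly (fun=> c).
Proof. by have := trig_poly_horner c%:P; congr trig_poly; apply/funext => z; rewrite hornerC. Qed.

(** On the circle the conjugate of z is its inverse. *)
Lemma trig_poly_conj (P : {poly C}) : trig_poly (fun z => (P.[z : C])^*%C).
Proof.
have tz : trig_poly (fun z => (z : C)^*%C).
  by exists 1%N, 1 => z; rewrite expr1 -sqr_normc normc_cabs cabs_circle expr1n hornerC.
elim/poly_ind: P => [|P c IH].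
  by have := trig_poly_cst 0; congr trig_poly; apply/funext => z; rewrite horner0 conjc0.
have := trig_polyD (trig_polyM IH tz) (trig_poly_cst c^*%C).
by congr trig_poly; apply/funext => z; rewrite !hornerE rmorphD rmorphM.
Qed.

(** This replaces the outer factorisation of a weight: multiplying a
    trigonometric polynomial by a power of z makes it analytic and keeps its
    modulus. *)
Lemma trig_poly_hardy f u : 0 < u -> trig_poly f ->
  exists2 h, fmem (Hardy_space u) h & forall z, cabs (h z) = cabs (f z).
Proof.
move=> u0 [N [P fP]]; exists (fun z : circle R => P.[z : C]); first exact: poly_hardy.
by move=> z; rewrite -fP cabsM cabsX cabs_circle expr1n mul1r.
Qed.

Lemma trig_poly_comp (Q : {poly R}) (G : circle R -> R) :
  trig_poly (fun z => (G z)%:C%C) -> trig_poly (fun z => (Q.[G z])%:C%C).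
Proof.
move=> tG; elim/poly_ind: Q => [|Q c IH].
  by have := trig_poly_cst 0; congr trig_poly; apply/funext => z; rewrite horner0.
have := trig_polyD (trig_polyM IH tG) (trig_poly_cst c%:C%C).
by congr trig_poly; apply/funext => z; rewrite !hornerE rmorphD rmorphM.
Qed.

Definition sqr_modulus (X : nat -> {poly C}) (j : nat) (z : circle R) : R :=
  cabs (X j).[z : C] ^+ 2.

Lemma trig_poly_weighted_sum (X : nat -> {poly C}) (b : nat -> R) n :
  trig_poly (fun z => (weighted_sum (sqr_modulus X) b n z)%:C%C).
Proof.
elim: n => [|n IH].
  by have := trig_poly_cst 0; congr trig_poly; apply/funext => z; rewrite /weighted_sum big_ord0.
have := trig_polyD IH (trig_polyM (trig_poly_cst (b n)%:C%C)
  (trig_polyM (trig_poly_horner (X n)) (trig_poly_conj (X n)))).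
congr trig_poly; apply/funext => z; rewrite /weighted_sum big_ord_recr/=.
by rewrite rmorphD rmorphM/= rmorphXn/= -normc_cabs sqr_normc.
Qed.

End trigonometric.

(** * The two operators *)

Section operators.
Variable R : realType.
Local Notation C := (R[i]).
Implicit Types (X : nat -> {poly C}) (t r u K L : R).

Lemma measurable_sqr_modulus X j : measurable_fun setT (sqr_modulus X j).
Proof. by apply: measurable_funX; apply: measurable_cabs; exact: cmeasurable_poly. Qed.

Lemma sqr_modulus_ge0 X j z : 0 <= sqr_modulus X j z.
Proof. exact: sqr_ge0. Qed.

Lemma sqr_modulus_bounded X j : exists M, forall z, sqr_modulus X j z <= M.
Proof.
have [M M0 PM] := poly_bounded (X j).
exists (M ^+ 2) => z; rewrite ler_sqr ?nnegrE ?cabs_ge0//.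
by apply: PM; rewrite cabs_circle.
Qed.

Lemma circle_LnormE u (f : circle R -> C) :
  circle_Lnorm u f = ((\int[haar]_z (cabs (f z) `^ u)%:E) `^ u^-1)%E.
Proof. by apply: (Lnorm_ge0E haar u) => z; exact: cabs_ge0. Qed.

Lemma seq_LnormE u (a : nat -> \bar R) : 0 < u -> (forall k, 0 <= a k)%E ->
  seq_Lnorm u a = ((\sum_(k <oo) (a k `^ u)) `^ u^-1)%E.
Proof.
move=> u0 a0; rewrite /seq_Lnorm Lnorm_counting//; congr (_ `^ _)%E.
by apply: eq_eseriesr => k _; rewrite gee0_abs.
Qed.

(** Passes between norm inequalities and inequalities of power integrals. *)
Lemma root_le_iff (S N : \bar R) K t : 0 < t -> 0 <= K -> (0 <= S)%E -> (0 <= N)%E ->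
  (S `^ t^-1 <= K%:E * N `^ t^-1)%E <-> (S <= (K `^ t)%:E * N)%E.
Proof.
move=> t0 K0 S0 N0; have t0' : 0 <= t^-1 by rewrite invr_ge0 ltW.
have pw (x y : \bar R) s : 0 <= s -> (0 <= x -> x <= y -> x `^ s <= y `^ s)%E.
  move=> s0 x0 xy; apply: gt0_ler_poweR; rewrite // in_itv/= leey andbT//.
  exact: le_trans xy.
have eK : ((K `^ t)%:E `^ t^-1 = K%:E)%E.
  by rewrite poweR_EFin -powRrM divff ?gt_eqF// powRr1.
split=> H.
- have := pw _ _ t (ltW t0) (poweR_ge0 _ _) H.
  rewrite poweRM ?poweR_ge0// -!poweRrM mulVf ?gt_eqF// !poweRe1//.
- have := pw _ _ _ t0' S0 H.
  by rewrite poweRM ?lee_fin ?powR_ge0// eK.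
Qed.

Lemma partial_le_eseries (a : nat -> \bar R) n : (forall k, 0 <= a k)%E ->
  (\sum_(k < n) a k <= \sum_(k <oo) a k)%E.
Proof.
move=> a0; rewrite -(big_mkord xpredT a).
by apply: nneseries_lim_ge => k _ _; exact: a0.
Qed.

Lemma eseries_le_iff (a : nat -> \bar R) (M : \bar R) : (forall k, 0 <= a k)%E ->
  (\sum_(k <oo) a k <= M)%E <-> (forall n, \sum_(k < n) a k <= M)%E.
Proof.
move=> a0; split=> [H n|H].
  exact: le_trans (partial_le_eseries n a0) H.
apply: lime_le; first by apply: is_cvg_nneseries => k _ _; exact: a0.
by apply: nearW => n; rewrite big_mkord.
Qed.

(** Since t = 2 q, the t-norm of the sequence of 2-norms of X_j h is the square
    root of the q-norm of the sequence int |X_j|^2 |h|^2; membership of every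
    X_j h in H^2 is automatic because X_j is a polynomial. *)
Lemma column_opP X K t q (phi : C -> C) p' :
  (forall j z, column_fun phi p' j z = (X j).[z]) ->
  1 <= q -> t = 2 * q ->
  op_bound (X := Hardy_space t) (Y := ell_Hardy2 t) (column phi p') K <->
  0 <= K /\ forall h, fmem (Hardy_space t) h ->
    column_bound haar (sqr_modulus X) q (K ^+ 2) (fun z => cabs (h z)).
Proof.
move=> cX q1 tq.
have q0 : 0 < q by rewrite (lt_le_trans ltr01).
have t0 : 0 < t by rewrite tq mulr_gt0.
have t2 : 2 <= t by rewrite tq ler_peMr.
pose c (h : circle R -> C) j := (\int[haar]_z (sqr_modulus X j z * cabs (h z) ^+ 2)%:E)%E.
have c0 h j : (0 <= c h j)%E.
  by apply: integral_ge0 => z _; rewrite lee_fin mulr_ge0// sqr_ge0.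
pose v (h : circle R -> C) j (z : circle R) := column_fun phi p' j z * h z.
have vN h j : circle_Lnorm 2 (v h j) = (c h j `^ 2^-1)%E.
  rewrite circle_LnormE; congr (_ `^ _)%E; apply: eq_integral => z _.
  by rewrite powR_mulrn ?cabs_ge0// cabsM cX exprMn.
have vS h : seq_Lnorm t (fun j => circle_Lnorm 2 (v h j)) =
    ((\sum_(k <oo) (c h k `^ q)) `^ t^-1)%E.
  rewrite seq_LnormE//; last by move=> k; rewrite vN poweR_ge0.
  congr (_ `^ _)%E; apply: eq_eseriesr => k _.
  by rewrite vN -poweRrM tq mulKf.
have equiv h : 0 <= K ->
    (seq_Lnorm t (fun j => circle_Lnorm 2 (v h j)) <= K%:E * circle_Lnorm t h)%E <->
    column_bound haar (sqr_modulus X) q (K ^+ 2) (fun z => cabs (h z)).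
  move=> K0; rewrite vS circle_LnormE root_le_iff//; last 2 first.
  - by apply: nneseries_ge0 => k _ _; exact: poweR_ge0.
  - by apply: integral_ge0 => z _; rewrite lee_fin powR_ge0.
  rewrite eseries_le_iff; last by move=> k; exact: poweR_ge0.
  rewrite /column_bound -(powR_mulrn 2 K0) -powRrM -tq; exact: iff_refl.
split=> [[K0 H]|[K0 H]]; split => //.
- move=> h Hh; have [y [yE _ yN]] := H h Hh.
  by apply/equiv => //; move: yN; rewrite yE.
- move=> h Hh; exists (v h); split; [exact: erefl| |exact: (equiv h K0).2 (H h Hh)].
  split.
    move=> j; rewrite (_ : v h j = fun z => (X j).[z : C] * h z).
      exact: poly_mul_hardy2 Hh.
    by apply/funext => z; rewrite /v cX.
  apply: le_lt_trans ((equiv h K0).2 (H h Hh)) _.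
  rewrite circle_LnormE; apply: lte_mul_pinfty; [by rewrite lee_fin|by []|].
  by apply: poweR_lty; exact: hardy_integral_lty.
Qed.

Lemma column_fun_sqr X (phi : C -> C) p' j (z : circle R) :
  (forall j z, column_fun phi p' j z = (X j).[z]) ->
  `|column_fun phi p' j z| ^+ 2 = (sqr_modulus X j z)%:C%C.
Proof. by move=> cX; rewrite cX normc_cabs -rmorphXn. Qed.

(** A finite nonnegative sequence, completed by zeros, lies in l^r, and its
    series is eventually equal to the weighted sum. *)
Lemma positive_op_boundW X L r (phi : C -> C) p' :
  (forall j z, column_fun phi p' j z = (X j).[z]) -> 0 < r ->
  op_bound (X := little_ell r) (Y := Lspace_circle r) (positive_column phi p') L ->
  0 <= L /\ positive_bound haar (sqr_modulus X) r L.
Proof.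
move=> cX r0 [L0 H]; split => // n b b0.
pose b' j : C := if (j < n)%N then (b j)%:C%C else 0.
have bN : seq_Lnorm r (fun j => (cabs (b' j))%:E) =
    (((\sum_(j < n) b j `^ r)%:E) `^ r^-1)%E.
  rewrite seq_LnormE//; last by move=> k; rewrite lee_fin cabs_ge0.
  congr (_ `^ _)%E; rewrite -sumEFin -(eseries_trunc (fun j => (b j `^ r)%:E)).
  apply: eq_eseriesr => k _; rewrite /b'; case: ifP => _.
    by rewrite cabsR ger0_norm.
  by rewrite (cabsR 0) normr0 poweR_EFin powR0// gt_eqF.
have Hb : fmem (little_ell r) b'.
  by rewrite /fmem/= bN; apply: poweR_lty; rewrite ltry.
have [y [yE [my _] yN]] := H b' Hb.
have yG : {ae haar, forall z : circle R,
    cabs (y z) = weighted_sum (sqr_modulus X) b n z}.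
  apply: filterS yE => z /cvg_cabs yz; apply: (cvg_unique _ yz) => //.
  apply: cvg_near_cst; near=> m.
  have nm : (n <= m)%N by near: m; exact: nbhs_infty_ge.
  rewrite -[RHS]ger0_norm; last by apply: weighted_sum_ge0 => // *; exact: sqr_ge0.
  rewrite -cabsR; congr cabs.
  rewrite (big_cat_nat (leq0n n) nm)//= [X in _ + X]big1_seq ?addr0; last first.
    move=> i /andP[_]; rewrite mem_index_iota => /andP[ni _].
    by rewrite /b' ltnNge ni mul0r.
  rewrite big_mkord rmorph_sum/=; apply: eq_bigr => i _.
  by rewrite /b' ltn_ord rmorphM/= (column_fun_sqr _ _ cX).
have S0 : (0 <= \int[haar]_z (cabs (y z) `^ r)%:E)%E by exact: integral_powR_ge0.
have N0 : (0 <= (\sum_(j < n) b j `^ r)%:E)%E.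
  by rewrite lee_fin sumr_ge0// => j _; exact: powR_ge0.
move: yN; rewrite /= bN circle_LnormE => /(root_le_iff r0 L0 S0 N0).
rewrite -EFinM; apply: le_trans.
rewrite le_eqVlt; apply/orP; left; apply/eqP.
apply: ae_eq_integral => //.
- apply/measurable_EFinP; apply: (@measurableT_comp _ _ _ _ _ _ (@powR R ^~ r)) => //.
  by apply: measurable_weighted_sum => j; exact: measurable_sqr_modulus.
- by apply/measurable_EFinP; exact: measurable_cabs_powR.
- by apply: filterS yG => z -> _.
Unshelve. all: by end_near. Qed.

(** By monotone convergence the increasing partial sums have a limit whose
    power r is integrable, so they are bounded almost everywhere. *)
Lemma ae_cvg_weighted_sum X L r (b : nat -> R) : 0 < r -> 0 <= L ->
  (forall j, 0 <= b j) -> (\sum_(k <oo) (b k `^ r)%:E < +oo)%E ->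
  positive_bound haar (sqr_modulus X) r L ->
  {ae haar, forall z : circle R, cvgn (series (fun j => b j * sqr_modulus X j z))}.
Proof.
move=> r0 L0 b0 bS PB.
pose G n (z : circle R) := weighted_sum (sqr_modulus X) b n z.
have G0 n z : 0 <= G n z by apply: weighted_sum_ge0 => // *; exact: sqr_ge0.
have Gnd z : {homo G^~ z : n m / (n <= m)%N >-> n <= m}.
  move=> n m nm; rewrite /G /weighted_sum -!(big_mkord xpredT (fun j => b j * sqr_modulus X j z)).
  rewrite (big_cat_nat (leq0n n) nm)/= lerDl; apply: sumr_ge0 => j _.
  by rewrite mulr_ge0// sqr_modulus_ge0.
pose g n (z : circle R) := ((G n z) `^ r)%:E.
have mg n : measurable_fun setT (g n).
  apply/measurable_EFinP; apply: (@measurableT_comp _ _ _ _ _ _ (@powR R ^~ r)) => //.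
  by apply: measurable_weighted_sum => j; exact: measurable_sqr_modulus.
have g0 n z : setT z -> (0 <= g n z)%E by move=> _; rewrite lee_fin powR_ge0.
have gnd z : setT z -> {homo g^~ z : n m / (n <= m)%N >-> (n <= m)%E}.
  move=> _ n m nm; rewrite lee_fin; apply: ge0_ler_powR; rewrite ?nnegrE//.
    exact: ltW.
  exact: Gnd.
have gcvg z : cvgn (g^~ z) by apply: ereal_nondecreasing_is_cvgn => n m; exact: gnd.
have M := @cvg_monotone_convergence _ _ _ haar setT measurableT g mg g0 gnd.
have Mfin : (\int[haar]_z limn (g^~ z) < +oo)%E.
  apply: (@le_lt_trans _ _ ((L `^ r)%:E * \sum_(k <oo) (b k `^ r)%:E)%E); last first.
    by apply: lte_mul_pinfty => //; rewrite lee_fin powR_ge0.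
  rewrite -(cvg_lim _ M)//; apply: lime_le; first by apply: cvgP M.
  apply: nearW => n; apply: le_trans (PB n b b0) _.
  rewrite EFinM -sumEFin lee_wpmul2l ?lee_fin ?powR_ge0//.
  by apply: partial_le_eseries => k; rewrite lee_fin powR_ge0.
have mlim : measurable_fun setT (fun z => limn (g^~ z)).
  apply: (@emeasurable_fun_cvg _ _ _ _ g) => // z _; exact: gcvg.
have lim0 z : (0 <= limn (g^~ z))%E.
  by apply: lime_ge => //; apply: nearW => n; exact: g0.
have ilim : haar.-integrable setT (fun z : circle R => limn (g^~ z)).
  apply/integrableP; split => //.
  by under eq_integral do rewrite gee0_abs//.
have := integrable_ae measurableT ilim; apply: filterS => z /(_ I) zfin.
apply: nondecreasing_is_cvgn.
  by move=> n m nm; rewrite !seriesEord; exact: Gnd.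
exists (fine (limn (g^~ z)) `^ r^-1) => _ [n _ <-].
have : (g n z <= limn (g^~ z))%E.
  by apply: lime_ge => //; exists n => // m nm; exact: gnd.
rewrite -(fineK zfin) lee_fin => Gn.
rewrite seriesEord -[leLHS]/(G n z).
have -> : G n z = (G n z `^ r) `^ r^-1.
  by rewrite -powRrM divff ?powRr1 ?G0// gt_eqF.
apply: ge0_ler_powR; [by rewrite invr_ge0 ltW| | |exact: Gn].
  exact: powR_ge0.
exact: fine_ge0 (lim0 z).
Qed.

(** A limit defined through upper limits, which are measurable even where the
    sequence diverges. *)
Definition limC (s : nat -> C) : C :=
  (fine (limn_esup (fun n => (complex.Re (s n))%:E)) +i*
   fine (limn_esup (fun n => (complex.Im (s n))%:E)))%C.

Lemma limCE (s : nat -> C) : cvgn (fun n => complex.Re (s n)) ->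
  cvgn (fun n => complex.Im (s n)) -> (s n : C^o) @[n --> \oo] --> (limC s : C^o).
Proof.
have limE (u : nat -> R) : cvgn u ->
    u n @[n --> \oo] --> fine (limn_esup (fun n => (u n)%:E)).
  move=> cu; have uE : (u n)%:E @[n --> \oo] --> (limn u)%:E.
    by apply: cvg_EFin; [exact: nearW|exact: cu].
  by rewrite (cvg_limn_einf_sup uE).
by move=> cr ci; apply: cvgC_ReIm; exact: limE.
Qed.

Lemma cmeasurable_limC (s : nat -> circle R -> C) : (forall n, cmeasurable (s n)) ->
  cmeasurable (fun z => limC (s^~ z)).
Proof.
move=> ms; have mlim (u : nat -> circle R -> R) : (forall n, measurable_fun setT (u n)) ->
    measurable_fun setT (fun z => fine (limn_esup (fun n => (u n z)%:E))).
  move=> mu; apply: (@measurableT_comp _ _ _ _ _ _ (@fine R)) => //.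
  apply: (@measurable_fun_limn_esup _ _ _ _ (fun n z => (u n z)%:E)) => n.
  exact/measurable_EFinP.
split; apply: mlim => n; [exact: (ms n).1|exact: (ms n).2].
Qed.

(** A complex series is dominated by the series of its moduli, which converges
    almost everywhere; Fatou's lemma carries the bound of the finite sums to
    its limit. *)
Lemma positive_op_boundP X L r (phi : C -> C) p' :
  (forall j z, column_fun phi p' j z = (X j).[z]) -> 0 < r ->
  op_bound (X := little_ell r) (Y := Lspace_circle r) (positive_column phi p') L <->
  0 <= L /\ positive_bound haar (sqr_modulus X) r L.
Proof.
move=> cX r0; split; first exact: positive_op_boundW.
move=> [L0 PB]; split => // b Hb.
pose a j := cabs (b j); have a0 j : 0 <= a j by exact: cabs_ge0.
have bN : seq_Lnorm r (fun j => (cabs (b j))%:E) =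
    ((\sum_(k <oo) (a k `^ r)%:E) `^ r^-1)%E.
  by rewrite seq_LnormE// => k; rewrite lee_fin.
have S0 : (0 <= \sum_(k <oo) (a k `^ r)%:E)%E.
  by apply: nneseries_ge0 => k _ _; rewrite lee_fin powR_ge0.
have Sfin : (\sum_(k <oo) (a k `^ r)%:E < +oo)%E.
  move: Hb; rewrite /fmem/= bN; apply: lty_poweRy.
  by rewrite invr_neq0// gt_eqF.
pose s n (z : circle R) := \sum_(0 <= j < n) b j * `|column_fun phi p' j z| ^+ 2.
have sRe n z : complex.Re (s n z) =
    series (fun j => complex.Re (b j) * sqr_modulus X j z) n.
  rewrite /s raddf_sum; apply: eq_bigr => j _; rewrite (column_fun_sqr _ _ cX).
  by case: (b j) => x y /=; rewrite mulr0 subr0.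
have sIm n z : complex.Im (s n z) =
    series (fun j => complex.Im (b j) * sqr_modulus X j z) n.
  rewrite /s raddf_sum; apply: eq_bigr => j _; rewrite (column_fun_sqr _ _ cX).
  by case: (b j) => x y /=; rewrite mulr0 add0r.
have ms n : cmeasurable (s n).
  split.
  - rewrite (_ : (fun x => _) = 
      fun z => \sum_(j <- index_iota 0 n) complex.Re (b j) * sqr_modulus X j z).
      by apply: measurable_sum => j; apply: measurable_funM => //; exact: measurable_sqr_modulus.
    by apply/funext => z; rewrite sRe.
  - rewrite (_ : (fun x => _) = 
      fun z => \sum_(j <- index_iota 0 n) complex.Im (b j) * sqr_modulus X j z).
      by apply: measurable_sum => j; apply: measurable_funM => //; exact: measurable_sqr_modulus.
    by apply/funext => z; rewrite sIm.
have sle n z : cabs (s n z) <= weighted_sum (sqr_modulus X) a n z.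
  rewrite /weighted_sum -(big_mkord xpredT (fun j => a j * sqr_modulus X j z)) /s.
  elim: n => [|n IH]; first by rewrite !big_geq// (cabsR 0) normr0.
  rewrite !big_nat_recr//=; apply: le_trans (cabsD _ _) _; apply: lerD IH _.
  by rewrite cabsM (column_fun_sqr _ _ cX) cabsR ger0_norm// sqr_modulus_ge0.
pose f z := limC (s^~ z).
have mf : cmeasurable f by exact: cmeasurable_limC.
have sf : {ae haar, forall z : circle R, (s n z : C^o) @[n --> \oo] --> (f z : C^o)}.
  have := ae_cvg_weighted_sum r0 L0 a0 Sfin PB; apply: filterS => z Hz.
  have abscvg (w : nat -> R) : (forall j, `|w j| <= a j) ->
      cvgn (series (fun j => w j * sqr_modulus X j z)).
    move=> wa; apply: normed_cvg; apply: (series_le_cvg _ _ _ Hz) => j.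
    - exact: normr_ge0.
    - by rewrite mulr_ge0// sqr_modulus_ge0.
    - by rewrite /= normrM ler_pM// ger0_norm// sqr_modulus_ge0.
  apply: limCE.
    rewrite (_ : (fun n => _) = series (fun j => complex.Re (b j) * sqr_modulus X j z)).
      by apply: abscvg => j; exact: cabs_Re.
    by apply/funext => n; rewrite sRe.
  rewrite (_ : (fun n => _) = series (fun j => complex.Im (b j) * sqr_modulus X j z)).
    by apply: abscvg => j; exact: cabs_Im.
  by apply/funext => n; rewrite sIm.
have fI : (\int[haar]_z (cabs (f z) `^ r)%:E <= (L `^ r)%:E * \sum_(k <oo) (a k `^ r)%:E)%E.
  apply: (@fatou_ae_bound _ (circle R) R haar (fun n (z : circle R) => cabs (s n z) `^ r)).
  - by move=> n; exact: measurable_cabs_powR.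
  - exact: measurable_cabs_powR.
  - by move=> *; exact: powR_ge0.
  - by apply: filterS sf => z; exact: cvg_cabs_powR.
  move=> n; apply: (@le_trans _ _ (L `^ r * \sum_(j < n) a j `^ r)%:E).
    apply: le_trans (PB n a a0); apply: ge0_le_integral => //.
    - by move=> z _; rewrite lee_fin powR_ge0.
    - by apply/measurable_EFinP; exact: measurable_cabs_powR.
    - apply/measurable_EFinP; apply: (@measurableT_comp _ _ _ _ _ _ (@powR R ^~ r)) => //.
      by apply: measurable_weighted_sum => j; exact: measurable_sqr_modulus.
    - move=> z _; rewrite lee_fin; apply: ge0_ler_powR; rewrite ?nnegrE ?cabs_ge0//.
        exact: ltW.
      exact: le_trans (cabs_ge0 _) (sle n z).
  rewrite EFinM -sumEFin lee_wpmul2l ?lee_fin ?powR_ge0//.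
  by apply: partial_le_eseries => k; rewrite lee_fin powR_ge0.
have fN : (circle_Lnorm r f <= L%:E * seq_Lnorm r (fun j => (cabs (b j))%:E))%E.
  rewrite circle_LnormE bN; apply/root_le_iff => //; exact: integral_powR_ge0.
exists f; split; [exact: sf| |exact: fN].
split; first exact: mf.
apply: le_lt_trans fN _; rewrite bN; apply: lte_mul_pinfty; [by rewrite lee_fin|by []|].
exact: poweR_lty.
Qed.

End operators.

(** * Equality of the norms *)

Section least_bounds.
Variable R : realType.

(** When the set of bounds of one operator is the set of square roots of the
    bounds of another, the least bounds are related in the same way; an empty
    set of bounds gives +oo on both sides. *)
Lemma ereal_inf_sqr (a b : R -> Prop) :
  (forall K, a K <-> 0 <= K /\ b (K ^+ 2)) -> (forall L, b L -> 0 <= L) ->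
  (ereal_inf [set K%:E | K in a] ^+ 2 = ereal_inf [set L%:E | L in b])%E.
Proof.
move=> ab b0; rewrite expe2.
set x := ereal_inf _; set y := ereal_inf [set L%:E | L in b].
have x0 : (0 <= x)%E by apply: le_ereal_inf_tmp => _ [K /ab[K0 _] <-]; rewrite lee_fin.
have y0 : (0 <= y)%E by apply: le_ereal_inf_tmp => _ [L /b0 L0 <-]; rewrite lee_fin.
apply/eqP; rewrite eq_le; apply/andP; split.
  apply: le_ereal_inf_tmp => _ [L bL <-].
  have L0 := b0 _ bL.
  have xs : (x <= (Num.sqrt L)%:E)%E.
    apply: ereal_inf_lbound; exists (Num.sqrt L) => //; apply/ab.
    by rewrite sqrtr_ge0 sqr_sqrtr.
  apply: le_trans (lee_pmul x0 x0 xs xs) _.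
  by rewrite -EFinM -expr2 sqr_sqrtr.
have [->|xy] := eqVneq x +oo%E; first by rewrite mulyy leey.
have xfin : x \is a fin_num by rewrite ge0_fin_numE// ltey.
have near_x e : 0 < e -> exists2 K, a K & K <= fine x + e.
  move=> e0; have [_ [K aK <-]] := lb_ereal_inf_adherent e0 xfin.
  by rewrite -/x -(fineK xfin) -EFinD lte_fin => /ltW; exists K.
have yK K : a K -> (y <= (K ^+ 2)%:E)%E.
  by move=> /ab[_ bK]; apply: ereal_inf_lbound; exists (K ^+ 2).
have yfin : y \is a fin_num.
  have [K /yK yK2 _] := near_x 1 ltr01.
  by rewrite ge0_fin_numE//; exact: le_lt_trans yK2 (ltry _).
rewrite -(fineK xfin) -(fineK yfin) -EFinM lee_fin -expr2 -[leRHS]mul1r.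
apply: squeeze_square => // [|e e0]; first exact: fine_ge0.
have [K aK Kx] := near_x e e0; have [K0 _] := (ab K).1 aK.
rewrite mul1r -lee_fin (fineK yfin); apply: le_trans (yK K aK) _.
by rewrite lee_fin ler_sqr ?nnegrE// (le_trans K0).
Qed.

End least_bounds.

Definition column_poly (R : realType) (phi : R[i] -> R[i]) (p' : R) (j : nat) :
    {poly R[i]} :=
  (2 `^ (- (j%:R / p')))%:C%C%:P *
    \sum_(2 ^ j <= n < 2 ^ j.+1) (taylor_coef phi n)%:P * 'X^n.

Lemma column_polyE (R : realType) (phi : R[i] -> R[i]) (p' : R) j z :
  column_fun phi p' j z = (column_poly phi p' j).[z].
Proof.
rewrite /column_fun /dyadic_block /column_poly hornerM hornerC horner_sum.
by congr (_ * _); apply: eq_bigr => n _; rewrite hornerM hornerC hornerXn.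
Qed.

(** The duality of the two estimates. Hardy functions realise enough
    weights: for a real polynomial Q and G = sum b_j |X_j|^2, the function Q(G)
    is a trigonometric polynomial, hence has the modulus of some h in H^(2 q). *)
Lemma positive_bound_columnP (R : realType) (X : nat -> {poly R[i]}) (r q L : R) :
  1 < r -> 1 <= q -> r^-1 + q^-1 = 1 -> 0 <= L ->
  positive_bound haar (sqr_modulus X) r L <->
  forall h, fmem (Hardy_space (2 * q)) h ->
    column_bound haar (sqr_modulus X) q L (fun z => cabs (h z)).
Proof.
move=> r1 q1 rq L0.
have r0 : 0 < r by rewrite (lt_trans ltr01).
have q0 : 0 < q by rewrite (lt_le_trans ltr01).
have q20 : 0 < 2 * q by rewrite mulr_gt0.
have mX := @measurable_sqr_modulus R X.
have X0 := @sqr_modulus_ge0 R X.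
have Xbd := @sqr_modulus_bounded R X.
split=> [PB h Hh|CB].
  apply: (column_of_positive mX X0 Xbd r0 q0 rq L0 _ _ _ PB).
  - by move=> z; exact: cabs_ge0.
  - by apply: measurable_cabs; case: Hh.
  - exact: hardy_integral_lty.
apply: (positive_of_column mX X0 Xbd r1 q1 rq L0) => b n Q b0.
have [h Hh hE] := trig_poly_hardy q20
  (trig_poly_comp Q (trig_poly_weighted_sum X b n)).
rewrite (_ : (fun z => _) = fun z => cabs (h z)); first exact: CB.
by apply/funext => z; rewrite hE cabsR.
Qed.

Theorem theorem4p1 (R : realType) (p p' r t : R) (phi : R[i] -> R[i])
    (hp : 2 < p) (hp' : p^-1 + p'^-1 = 1)
    (hr : r = p / 2) (ht : t = 2 * p / (p - 2))
    (hphi : holomorphic_disc phi) :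
  (op_bounded (little_ell r) (Lspace_circle r) (positive_column phi p') <->
   op_bounded (Hardy_space t) (ell_Hardy2 t) (column phi p')) /\
  (op_norm (Hardy_space t) (ell_Hardy2 t) (column phi p') ^+ 2 =
   op_norm (little_ell r) (Lspace_circle r) (positive_column phi p'))%E.
Proof.
pose q := p / (p - 2).
have p20 : 0 < p - 2 by rewrite subr_gt0.
have p0 : 0 < p by rewrite (lt_trans _ hp).
have r1 : 1 < r by rewrite hr ltr_pdivlMr// mul1r.
have r0 : 0 < r by rewrite (lt_trans ltr01).
have q1 : 1 <= q by rewrite ler_pdivlMr// mul1r lerBlDr lerDl.
have rq : r^-1 + q^-1 = 1.
  by rewrite hr /q; field; rewrite !gt_eqF.
have tq : t = 2 * q by rewrite ht mulrA.
have cX := column_polyE phi p'.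
pose a K := op_bound (X := Hardy_space t) (Y := ell_Hardy2 t) (column phi p') K.
pose b L := op_bound (X := little_ell r) (Y := Lspace_circle r) (positive_column phi p') L.
have ab K : a K <-> 0 <= K /\ b (K ^+ 2).
  rewrite /a /b (column_opP _ cX q1 tq) (positive_op_boundP _ cX r0).
  have PC := positive_bound_columnP (column_poly phi p') r1 q1 rq (sqr_ge0 K).
  rewrite tq; split=> -[K0 H]; split=> //.
    by split; [exact: sqr_ge0|exact/PC].
  by apply/PC; case: H.
have b0 L : b L -> 0 <= L by case.
split; last exact: ereal_inf_sqr.
split=> [[L bL]|[K /ab[_ bK]]]; last by exists (K ^+ 2).
exists (Num.sqrt L); apply/ab.
by rewrite sqrtr_ge0 sqr_sqrtr//; exact: b0.
Qed.
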